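(* The cactus Thompson group $CV$ is finitely presented.
   Context: Trees. A rooted binary tree is a single vertex or a finite rooted tree in which every non-leaf vertex has a left child and a right child; its $n$ leaves are numbered $1,\dots,n$ from left to right. A caret is the rooted binary tree with two leaves. Attaching a caret to a leaf means identifying the root of the caret with that leaf. Cactus groups. $J_1=\{1\}$; for $n\ge2$, $J_n$ is generated by $s_{i,j}$ $(1\le i<j\le n)$ with relations $s_{i,j}^2=1$; $s_{i,j}s_{k,l}=s_{k,l}s_{i,j}$ for $i<j<k<l$; $s_{i,j}s_{k,l}=s_{i+j-l,i+j-k}s_{i,j}$ for $i\le k<l\le j$. The homomorphism $\pi_n:J_n\to S_n$ sends $s_{i,j}$ to the permutation $m\mapsto i+j-m$ for $i\le m\le j$, fixing all other $m$. Permutations are composed left to right: $(\sigma\tau)(m)=\tau(\sigma(m))$. The group $CV$. A cactus-tree pair is a triple $(T_+,s,T_-)$ with $T_\pm$ rooted binary trees with the same number $n$ of leaves and $s\in J_n$. For $1\le i\le n$, writing $s=s_{j_1,k_1}\cdots s_{j_l,k_l}$, put $p_1=i$ and let $p_{m+1}$ be the image of $p_m$ under $\pi_n(s_{j_m,k_m})$. Set $s'=s'_1\cdots s'_l\in J_{n+1}$, where $s'_m=s_{j_m,k_m}$ if $k_m<p_m$; $s'_m=s_{p_m,p_m+1}s_{j_m,k_m+1}$ if $j_m\le p_m\le k_m$; $s'_m=s_{j_m+1,k_m+1}$ if $p_m<j_m$. Attaching a caret to leaf $i$ of $T_+$ and to leaf $\pi_n(s)(i)$ of $T_-$ gives $T'_+,T'_-$;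 the triple $(T'_+,s',T'_-)$ is called an expansion of $(T_+,s,T_-)$. $CV$ is the set of cactus-tree pairs modulo the equivalence relation generated by expansions. Product: given two classes, choose representatives $(S_+,s,S_-)$, $(T_+,t,T_-)$ with $S_-=T_+$; the product is the class of $(S_+,st,T_-)$. The identity is the class of $(T,1,T)$ and the inverse of $(T_+,s,T_-)$ is $(T_-,s^{-1},T_+)$. *)

(* Defs.v *)
From Stdlib Require Import Relation_Operators.
From HB Require Import structures.
From mathcomp Require Import all_boot all_fingroup.
From mathcomp Require Import generic_quotient zify.
From mathcomp Require Import boolp classical_sets.

Set Implicit Arguments.
Unset Strict Implicit.
Unset Printing Implicit Defensive.

Local Open Scope group_scope.
Local Open Scope quotient_scope.

(* The letter (x, false) stands for x and (x, true) for its formal inverse.  *)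
Definition word (X : Type) := seq (X * bool).

Definition pos_word (X : Type) (s : seq X) : word X := [seq (x, false) | x <- s].

Section PresentedGroup.
Variables (X : choiceType) (R : word X -> word X -> Prop).

Inductive elementary : word X -> word X -> Prop :=
| Cancel u v x b : elementary (u ++ [:: (x, b); (x, ~~ b)] ++ v) (u ++ v)
| Relation u v l r : R l r -> elementary (u ++ l ++ v) (u ++ r ++ v).

Definition same_element := clos_refl_sym_trans _ elementary.

Definition same_elementb : rel (word X) := fun u v => `[< same_element u v >].

Lemma same_element_equiv : equiv_class_of same_elementb.
Proof.
split.
- by move=> u; apply/asboolP/rst_refl.
- move=> u v; apply/asboolP/asboolP; exact: rst_sym.
- by move=> v u w /asboolP uv /asboolP vw; apply/asboolP/(rst_trans _ _ _ _ _ uv).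
Qed.

Canonical same_element_equiv_rel := EquivRelPack same_element_equiv.

(* The group <X | l = r for (l, r) in R>. *)
Definition presented := {eq_quot same_elementb}.
HB.instance Definition _ : EqQuotient _ same_elementb presented :=
  EqQuotient.on presented.
HB.instance Definition _ := Choice.on presented.

Definition pres_class (w : word X) : presented := \pi_presented w.

Lemma pres_classP u v : same_element u v <-> pres_class u = pres_class v.
Proof.
split=> [uv|].
  by rewrite /pres_class; apply/eqmodP/asboolP.
by move=> /eqmodP/asboolP.
Qed.

Lemma same_element_cat u u' v v' :
  same_element u u' -> same_element v v' -> same_element (u ++ v) (u' ++ v').
Proof.
move=> uu' vv'; apply: (rst_trans _ _ _ (u' ++ v)).
  elim: uu' => {u u'} [_ _ []|u|u u' _|u1 u2 u3 _ h1 _ h2].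
  - by move=> u w x b; apply: rst_step; rewrite -!catA; exact: Cancel.
  - by move=> u w l r lr; apply: rst_step; rewrite -!catA; exact: Relation.
  - exact: rst_refl.
  - exact: rst_sym.
  - exact: rst_trans h1 h2.
elim: vv' => {v v'} [_ _ []|v|v v' _|v1 v2 v3 _ h1 _ h2].
- by move=> v w x b; apply: rst_step; rewrite !(catA u'); exact: Cancel.
- by move=> v w l r lr; apply: rst_step; rewrite !(catA u'); exact: Relation.
- exact: rst_refl.
- exact: rst_sym.
- exact: rst_trans h1 h2.
Qed.

Definition inv_word (w : word X) : word X := rev [seq (a.1, ~~ a.2) | a <- w].

Lemma inv_word_cat u v : inv_word (u ++ v) = inv_word v ++ inv_word u.
Proof. by rewrite /inv_word map_cat rev_cat. Qed.

Lemma inv_wordK : involutive inv_word.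
Proof.
move=> w; rewrite /inv_word map_rev revK -map_comp -[RHS]map_id.
by apply: eq_map => -[x b] /=; rewrite negbK.
Qed.

Lemma same_element_invr w : same_element (w ++ inv_word w) [::].
Proof.
elim: w => [|[x b] w IH]; first exact: rst_refl.
rewrite (_ : _ ++ _ = [:: (x, b)] ++ (w ++ inv_word w) ++ [:: (x, ~~ b)]); last first.
  by rewrite /inv_word /= rev_cons cats1 -rcons_cat.
apply: (rst_trans _ _ _ ([:: (x, b)] ++ [::] ++ [:: (x, ~~ b)])).
  apply: same_element_cat; first exact: rst_refl.
  by apply: same_element_cat IH _; exact: rst_refl.
by apply: rst_step; exact: (Cancel [::] [::]).
Qed.

Lemma same_element_invl w : same_element (inv_word w ++ w) [::].
Proof. by have := same_element_invr (inv_word w); rewrite inv_wordK. Qed.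

Definition pres_one : presented := pres_class [::].
Definition pres_mul (x y : presented) : presented :=
  pres_class (repr x ++ repr y).
Definition pres_inv (x : presented) : presented := pres_class (inv_word (repr x)).

Lemma pres_reprK x : pres_class (repr x) = x.
Proof. exact: reprK. Qed.

Lemma pres_repr_class w : same_element (repr (pres_class w)) w.
Proof. by apply/pres_classP; rewrite pres_reprK. Qed.

Lemma pres_class_mul u v : pres_mul (pres_class u) (pres_class v) = pres_class (u ++ v).
Proof. by apply/pres_classP; apply: same_element_cat; exact: pres_repr_class. Qed.

Lemma pres_mulA : associative pres_mul.
Proof.
move=> x y z; rewrite -[x]pres_reprK -[y]pres_reprK -[z]pres_reprK.
by rewrite !pres_class_mul catA.
Qed.

Lemma pres_mul1 : left_id pres_one pres_mul.
Proof. by move=> x; rewrite -[x]pres_reprK pres_class_mul. Qed.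

Lemma pres_1mul : right_id pres_one pres_mul.
Proof. by move=> x; rewrite -[x]pres_reprK pres_class_mul cats0. Qed.

Lemma pres_mulV : left_inverse pres_one pres_inv pres_mul.
Proof.
move=> x; rewrite -{2}[x]pres_reprK /pres_inv pres_class_mul.
by apply/pres_classP; exact: same_element_invl.
Qed.

Lemma pres_mulVr : right_inverse pres_one pres_inv pres_mul.
Proof.
move=> x; rewrite -{1}[x]pres_reprK /pres_inv pres_class_mul.
by apply/pres_classP; exact: same_element_invr.
Qed.

HB.instance Definition _ := isGroup.Build presented
  pres_mulA pres_mul1 pres_1mul pres_mulV pres_mulVr.

Definition pres_gen (x : X) : presented := pres_class [:: (x, false)].

Lemma pres_classM u v : pres_class (u ++ v) = pres_class u * pres_class v.
Proof. by rewrite -pres_class_mul. Qed.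

Lemma pres_class_pos s : pres_class (pos_word s) = \prod_(x <- s) pres_gen x.
Proof.
elim: s => [|x s IH]; first by rewrite big_nil.
by rewrite big_cons -IH -pres_classM.
Qed.

Variables (G : groupType) (f : X -> G).

Definition word_eval (w : word X) : G :=
  \prod_(a <- w) (if a.2 then (f a.1)^-1 else f a.1).

(* This is the homomorphism induced by f only when f respects R, see        *)
(* pres_liftM.                                                               *)
Definition pres_lift (x : presented) : G := word_eval (repr x).

Hypothesis fR : forall l r, R l r -> word_eval l = word_eval r.

Lemma word_eval_cat u v : word_eval (u ++ v) = word_eval u * word_eval v.
Proof. exact: big_cat. Qed.

Lemma word_eval_same u v : same_element u v -> word_eval u = word_eval v.
Proof.
elim=> {u v} [_ _ []|//|u v _ //|u v w _ -> _ //].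
- move=> u v x b; rewrite !word_eval_cat; congr (_ * _).
  rewrite /word_eval big_cons big_seq1 /=.
  by case: b; rewrite /= ?mulgV ?mulVg mul1g.
- by move=> u v l r lr; rewrite !word_eval_cat (fR lr).
Qed.

Lemma pres_lift_class w : pres_lift (pres_class w) = word_eval w.
Proof. exact/word_eval_same/pres_repr_class. Qed.

Lemma pres_lift_gen x : pres_lift (pres_gen x) = f x.
Proof. by rewrite pres_lift_class /word_eval big_seq1. Qed.

Lemma pres_liftM : {morph pres_lift : x y / x * y}.
Proof.
move=> x y; rewrite -[x]pres_reprK -[y]pres_reprK -pres_classM.
by rewrite !pres_lift_class word_eval_cat.
Qed.

End PresentedGroup.

Definition finitely_presented (G : groupType) : Prop :=
  exists (n : nat) (R : seq (word 'I_n * word 'I_n))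
         (f : presented (fun u v : word 'I_n => (u, v) \in R) -> G),
    {morph f : x y / x * y} /\ bijective f.

(* Leaves, and the indices of the generators s_{i,j}, are numbered from 0    *)
(* rather than from 1; the relations are unchanged by this shift.            *)
Definition cactus_index (n : nat) := {p : nat * nat | p.1 < p.2 < n}.

Inductive cactus_rel (n : nat) :
  word (cactus_index n) -> word (cactus_index n) -> Prop :=
| CactusInvolution g : cactus_rel (pos_word [:: g; g]) [::]
| CactusDisjoint g h :
    (val g).2 < (val h).1 -> cactus_rel (pos_word [:: g; h]) (pos_word [:: h; g])
| CactusNested g h h' :
    (val g).1 <= (val h).1 -> (val h).2 <= (val g).2 ->
    val h' = ((val g).1 + (val g).2 - (val h).2,
              (val g).1 + (val g).2 - (val h).1)%N ->
    cactus_rel (pos_word [:: g; h]) (pos_word [:: h'; g]).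

Definition cactus (n : nat) := presented (@cactus_rel n).
HB.instance Definition _ n := Group.on (cactus n).

Definition cactus_gen (n : nat) (g : cactus_index n) : cactus n := pres_gen _ g.

(* s_{i,j}, with the junk value 1 unless i < j < n. *)
Definition sgen (n i j : nat) : cactus n :=
  if insub (i, j) is Some g then cactus_gen g else 1.

Definition flip (i j m : nat) : nat := if i <= m <= j then (i + j - m)%N else m.

Lemma flipP i j m :
  i <= m <= j /\ flip i j m = (i + j - m)%N \/
  ~~ (i <= m <= j) /\ flip i j m = m.
Proof. by rewrite /flip; case: ifP; [left|right]. Qed.

Ltac flips := repeat match goal with
  |- context [flip ?i ?j ?m] =>
    lazymatch m with context [flip] => fail | _ =>
      move: (flipP i j m); generalize (flip i j m) => ? end
  end.

Lemma flip_ltn n (g : cactus_index n) (m : 'I_n) :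
  flip (val g).1 (val g).2 m < n.
Proof. by case: g m => -[i j] /= h [m hm]; rewrite /flip /=; case: ifP; lia. Qed.

Definition flip_ord n (g : cactus_index n) (m : 'I_n) : 'I_n :=
  Ordinal (flip_ltn g m).

Lemma flipK i j : involutive (flip i j).
Proof. by move=> m; rewrite /flip; do 2 case: ifP; lia. Qed.

Lemma flip_ordK n (g : cactus_index n) : involutive (flip_ord g).
Proof. by move=> m; apply: val_inj => /=; rewrite flipK. Qed.

Definition flip_perm n (g : cactus_index n) : 'S_n := perm (can_inj (flip_ordK g)).

(* MathComp multiplies permutations left to right: (s * t) m = t (s m).     *)
Definition cactus_perm (n : nat) (s : cactus n) : 'S_n := pres_lift (@flip_perm n) s.

Lemma flip_permE n (g : cactus_index n) (m : 'I_n) :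
  flip_perm g m = flip (val g).1 (val g).2 m :> nat.
Proof. by rewrite permE. Qed.

Lemma flip_perm_rel n l r : cactus_rel l r ->
  word_eval (@flip_perm n) l = word_eval (@flip_perm n) r.
Proof.
case=> {l r} [g|[[i j] ij] [[k l] kl] /= gh|[[i j] ij] [[k l] kl] [[k' l'] kl'] /= gh1 gh2 [e1 e2]];
  apply/permP => m; apply: val_inj;
  rewrite /word_eval /= ?big_cons ?big_nil ?mulg1 ?permM ?perm1 /= !flip_permE /=.
- exact: flipK.
- by move: ij kl; rewrite ?e1 ?e2 /=; flips; lia.
- by move: ij kl; rewrite ?e1 ?e2 /=; flips; lia.
Qed.

Lemma cactus_perm_gen n (g : cactus_index n) : cactus_perm (cactus_gen g) = flip_perm g.
Proof. exact/pres_lift_gen/flip_perm_rel. Qed.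

Lemma cactus_permM n : {morph @cactus_perm n : s t / s * t}.
Proof. exact/pres_liftM/flip_perm_rel. Qed.

Definition cactus_word n (w : seq (cactus_index n)) : cactus n :=
  \prod_(g <- w) cactus_gen g.

Definition expand_gen n (p : nat) (g : cactus_index n) : cactus n.+1 :=
  let: (j, k) := val g in
  if k < p then sgen n.+1 j k
  else if p < j then sgen n.+1 j.+1 k.+1
  else sgen n.+1 p p.+1 * sgen n.+1 j k.+1.

(* The element s' attached to the factorization w of s and to the leaf p;    *)
(* by expand_wordE and xpd_class it depends only on s and p.                 *)
Fixpoint expand_word n (p : 'I_n) (w : seq (cactus_index n)) : cactus n.+1 :=
  if w is g :: w' then
    expand_gen p g * expand_word (cactus_perm (cactus_gen g) p) w'
  else 1.

Inductive tree := Leaf | Node (l r : tree).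

HB.instance Definition _ := gen_eqMixin tree.
HB.instance Definition _ := gen_choiceMixin tree.

Fixpoint leaves (t : tree) : nat :=
  if t is Node l r then (leaves l + leaves r)%N else 1%N.

Definition caret := Node Leaf Leaf.

(* Meaningful for i < leaves t. *)
Fixpoint attach (t : tree) (i : nat) : tree :=
  if t is Node l r then
    if i < leaves l then Node (attach l i) r else Node l (attach r (i - leaves l))
  else caret.

Lemma leaves_attach t i : leaves (attach t i) = (leaves t).+1.
Proof.
elim: t i => [|l IHl r IHr] i //=.
by case: ifP => _ /=; rewrite ?IHl ?IHr ?addSn ?addnS.
Qed.

Definition ntree (n : nat) := {t : tree | leaves t == n}.

Lemma attach_subproof n (t : ntree n) (i : 'I_n) : leaves (attach (val t) i) == n.+1.
Proof. by rewrite leaves_attach (eqP (valP t)). Qed.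

Definition nattach n (t : ntree n) (i : 'I_n) : ntree n.+1 :=
  Sub (attach (val t) i) (attach_subproof t i).

Definition cactus_tree_pair := {n : nat & (ntree n * cactus n * ntree n)%type}.

Definition ctp n (Tp : ntree n) (s : cactus n) (Tm : ntree n) : cactus_tree_pair :=
  Tagged _ (Tp, s, Tm).

Inductive expansion : cactus_tree_pair -> cactus_tree_pair -> Prop :=
| Expansion n (Tp Tm : ntree n) (w : seq (cactus_index n)) (i : 'I_n) :
    expansion (ctp Tp (cactus_word w) Tm)
      (ctp (nattach Tp i) (expand_word i w)
           (nattach Tm (cactus_perm (cactus_word w) i))).

Definition ctp_equiv := clos_refl_sym_trans _ expansion.

Lemma cactus_ind n (Q : cactus n -> Prop) :
  Q 1 -> (forall g s, Q s -> Q (cactus_gen g * s)) -> forall s, Q s.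
Proof.
move=> Q1 QM s; rewrite -[s]pres_reprK.
elim: (repr s) => [|[g b] w IH]; first exact: Q1.
have -> : pres_class (@cactus_rel n) ((g, b) :: w) = cactus_gen g * pres_class _ w.
  rewrite /cactus_gen /pres_gen -pres_classM; case: b => //.
  apply/pres_classP; rewrite -cat1s; apply: same_element_cat; last exact: rst_refl.
  apply: (rst_trans _ _ _ ([::] ++ pos_word [:: g; g] ++ [:: (g, true)])).
    exact/rst_sym/rst_step/(Relation [::] [:: (g, true)] (CactusInvolution g)).
  exact/rst_step/(Cancel _ [:: (g, false)] [::]).
exact: QM.
Qed.

Lemma cactus_wordP n (s : cactus n) : exists w, s = cactus_word w.
Proof.
elim/cactus_ind: s => [|g s [w ->]]; first by exists [::]; rewrite /cactus_word big_nil.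
by exists (g :: w); rewrite /cactus_word big_cons.
Qed.

Lemma cactus_rel_eq n l r : cactus_rel l r ->
  pres_class (@cactus_rel n) l = pres_class (@cactus_rel n) r.
Proof.
move=> lr; apply/pres_classP/rst_step; rewrite -[l]cats0 -[r]cats0.
exact: (Relation [::]).
Qed.

Lemma cactus_pos2 n (g h : cactus_index n) :
  pres_class (@cactus_rel n) (pos_word [:: g; h]) = cactus_gen g * cactus_gen h.
Proof. by rewrite pres_class_pos big_cons big_seq1. Qed.

Lemma sgenE n i j (h : (i, j).1 < (i, j).2 < n) :
  sgen n i j = cactus_gen (exist _ (i, j) h).
Proof. by rewrite /sgen insubT. Qed.

Lemma sgen_junk n i j : ~~ (i < j < n) -> sgen n i j = 1.
Proof. by move=> h; rewrite /sgen insubF //; apply/negbTE. Qed.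

Lemma sgen_sval n (g : cactus_index n) : cactus_gen g = sgen n (val g).1 (val g).2.
Proof. by case: g => -[i j] h /=; rewrite sgenE. Qed.

Lemma sgenK n i j : sgen n i j * sgen n i j = 1.
Proof.
have [h|/sgen_junk ->] := boolP (i < j < n); last exact: mul1g.
by rewrite sgenE -cactus_pos2; apply/cactus_rel_eq/CactusInvolution.
Qed.

Lemma sgenC n i j k l : j < k -> sgen n i j * sgen n k l = sgen n k l * sgen n i j.
Proof.
move=> jk; have [h|/sgen_junk ->] := boolP (i < j < n); last by rewrite mul1g mulg1.
have [h'|/sgen_junk ->] := boolP (k < l < n); last by rewrite mul1g mulg1.
by rewrite !sgenE -!cactus_pos2; apply/cactus_rel_eq/CactusDisjoint.
Qed.

Lemma sgenN n i j k l k' l' : i <= k -> k < l -> l <= j -> j < n ->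
  k' = (i + j - l)%N -> l' = (i + j - k)%N ->
  sgen n i j * sgen n k l = sgen n k' l' * sgen n i j.
Proof.
move=> ik kl lj jn e1 e2.
have h1 : i < j < n by lia.
have h2 : k < l < n by lia.
have h3 : k' < l' < n by lia.
rewrite !sgenE -!cactus_pos2; apply/cactus_rel_eq/CactusNested => //=.
by rewrite e1 e2.
Qed.

Fixpoint xword n (p : nat) (w : word (cactus_index n)) : cactus n.+1 :=
  if w is a :: w' then
    expand_gen p a.1 * xword (flip (val a.1).1 (val a.1).2 p) w'
  else 1.

Fixpoint pword n (p : nat) (w : word (cactus_index n)) : nat :=
  if w is a :: w' then pword (flip (val a.1).1 (val a.1).2 p) w' else p.

Lemma pword_cat n p (u v : word (cactus_index n)) :
  pword p (u ++ v) = pword (pword p u) v.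
Proof. by elim: u p => //= a u IH p. Qed.

Lemma xword_cat n p (u v : word (cactus_index n)) :
  xword p (u ++ v) = xword p u * xword (pword p u) v.
Proof. by elim: u p => /= [p|a u IH p]; rewrite ?mul1g // IH mulgA. Qed.

Lemma expand_gen_cases n p (g : cactus_index n) (j := (val g).1) (k := (val g).2) :
  [\/ k < p /\ expand_gen p g = sgen n.+1 j k,
      p < j /\ expand_gen p g = sgen n.+1 j.+1 k.+1 |
      j <= p <= k /\ expand_gen p g = sgen n.+1 p p.+1 * sgen n.+1 j k.+1].
Proof.
rewrite {}/j {}/k /expand_gen; case: g => -[j k] /= h.
case: ifP => kp; first by constructor 1.
case: ifP => pj; first by constructor 2.
by constructor 3; split=> //; lia.
Qed.

Ltac xgen := repeat match goal with
  | |- context [flip ?i ?j ?m] =>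
    lazymatch m with context [flip] => fail | _ =>
      case: (flipP i j m) => -[? ->] /=; try (exfalso; lia) end
  | |- context [expand_gen ?p ?g] =>
    case: (expand_gen_cases p g) => -[/= ? ->] /=; try (exfalso; lia)
  end.

Lemma mulg_slide (G : groupType) (a b c d : G) :
  a * a = 1 -> b * c = a * b -> a * b * (c * d) = b * d.
Proof. by move=> aa bc; rewrite -!mulgA (mulgA b c) bc !mulgA aa mul1g. Qed.

Lemma expand_gen_invol n p (g : cactus_index n) :
  expand_gen p g * expand_gen (flip (val g).1 (val g).2 p) g = 1.
Proof.
case: g => -[j k] jk; have /= jkn := jk; xgen; rewrite ?sgenK //.
match goal with |- sgen _ ?p _ * _ * (sgen _ ?q _ * _) = _ =>
  rewrite -mulgA [sgen _ j _ * (_ * _)]mulgA (@sgenN _ j k.+1 q q.+1 p p.+1); try lia end.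
by rewrite -!mulgA sgenK mulg1 sgenK.
Qed.

Lemma xword_rel n l r : @cactus_rel n l r ->
  forall p, xword p l = xword p r /\ pword p l = pword p r.
Proof.
case=> {l r} [g p|[[i j] ij] [[k l] kl] /= gh p|[[i j] ij] [[k l] kl] [[k' l'] kl'] /= gh1 gh2 [e1 e2] p].
- by rewrite /= mulg1 expand_gen_invol flipK.
- have /= ijn := ij; have /= kln := kl; rewrite !mulg1; split; last by flips; lia.
  xgen; try by rewrite sgenC //; lia.
  + rewrite -mulgA (@sgenC _ i j.+1 k.+1); last by lia.
    by rewrite !mulgA (@sgenC _ p p.+1 k.+1) //; lia.
  + rewrite mulgA (@sgenC _ i j p) //.
    by rewrite -!mulgA sgenC //; lia.
- have /= ijn := ij; have /= kln := kl; have /= kln' := kl'; rewrite !mulg1.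
  split; last by flips; lia.
  xgen; try by apply: sgenN; lia.
  + set q := (i + j - p)%N; set r := (k' + l' - p)%N.
    have e : sgen n.+1 i j.+1 * sgen n.+1 q q.+1 = sgen n.+1 p p.+1 * sgen n.+1 i j.+1.
      by apply: sgenN; lia.
    have e' : sgen n.+1 k' l'.+1 * sgen n.+1 r r.+1 = sgen n.+1 p p.+1 * sgen n.+1 k' l'.+1.
      by apply: sgenN; lia.
    have e'' : sgen n.+1 i j.+1 * sgen n.+1 k l.+1 = sgen n.+1 k' l'.+1 * sgen n.+1 i j.+1.
      by apply: sgenN; lia.
    by rewrite (mulg_slide _ (sgenK _ _ _) e) (mulg_slide _ (sgenK _ _ _) e') e''.
  + rewrite -mulgA (@sgenN _ i j.+1 k l k'.+1 l'.+1); try lia.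
    by rewrite !mulgA; congr (_ * _); apply: sgenC; lia.
  + rewrite -mulgA (@sgenN _ i j.+1 k.+1 l.+1 k' l'); try lia.
    rewrite !mulgA; congr (_ * _); symmetry; apply: sgenC; lia.
Qed.

Lemma xword_same n (u v : word (cactus_index n)) :
  same_element (@cactus_rel n) u v ->
  forall p, xword p u = xword p v /\ pword p u = pword p v.
Proof.
elim=> {u v} [_ _ []|//|u v _ IH p|u v w _ IHu _ IHv p].
- move=> u v g b p; rewrite !xword_cat !pword_cat /=; split; last by rewrite flipK.
  by congr (_ * _); rewrite mulg1 expand_gen_invol mul1g flipK.
- move=> u v l r lr p; rewrite !xword_cat !pword_cat.
  by have [-> ->] := xword_rel lr (pword p u).
- by have [-> ->] := IH p.
- by have [-> ->] := IHu p; have [-> ->] := IHv p.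
Qed.

Definition xpd n (p : nat) (s : cactus n) : cactus n.+1 := xword p (repr s).
Definition pos n (p : nat) (s : cactus n) : nat := pword p (repr s).

Lemma xpd_class n p w : xpd p (pres_class (@cactus_rel n) w) = xword p w.
Proof. by have [] := xword_same (pres_repr_class (@cactus_rel n) w) p. Qed.

Lemma pos_class n p w : pos p (pres_class (@cactus_rel n) w) = pword p w.
Proof. by have [] := xword_same (pres_repr_class (@cactus_rel n) w) p. Qed.

Lemma xpdM n p (s t : cactus n) : xpd p (s * t) = xpd p s * xpd (pos p s) t.
Proof.
rewrite -[s]pres_reprK -[t]pres_reprK -pres_classM.
by rewrite !xpd_class pos_class xword_cat.
Qed.

Lemma posM n p (s t : cactus n) : pos p (s * t) = pos (pos p s) t.
Proof.
rewrite -[s]pres_reprK -[t]pres_reprK -pres_classM.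
by rewrite !pos_class pword_cat.
Qed.

Lemma xpd1 n p : xpd p (1 : cactus n) = 1.
Proof. exact: (xpd_class p [::]). Qed.

Lemma pos1 n p : pos p (1 : cactus n) = p.
Proof. exact: (pos_class p [::]). Qed.

Lemma xpd_gen n p (g : cactus_index n) : xpd p (cactus_gen g) = expand_gen p g.
Proof. by rewrite /cactus_gen /pres_gen xpd_class /= mulg1. Qed.

Lemma pos_gen n p (g : cactus_index n) :
  pos p (cactus_gen g) = flip (val g).1 (val g).2 p.
Proof. exact: pos_class. Qed.

Lemma posK n p (s : cactus n) : pos (pos p s) s^-1 = p.
Proof. by rewrite -posM mulgV pos1. Qed.

Lemma xpdV n p (s : cactus n) : xpd (pos p s) s^-1 = (xpd p s)^-1.
Proof. by apply: (mulgI (xpd p s)); rewrite mulgV -xpdM mulgV xpd1. Qed.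

Lemma cactus_perm1 n : cactus_perm (1 : cactus n) = 1.
Proof. by apply: (mulgI (cactus_perm 1)); rewrite -cactus_permM !mulg1. Qed.

Lemma posE n (s : cactus n) (i : 'I_n) : cactus_perm s i = pos i s :> nat.
Proof.
elim/cactus_ind: s i => [|g s IH] i.
  by rewrite pos1 cactus_perm1 perm1.
by rewrite cactus_permM permM IH posM cactus_perm_gen flip_permE pos_gen.
Qed.

Lemma expand_wordE n (w : seq (cactus_index n)) (i : 'I_n) :
  expand_word i w = xpd i (cactus_word w).
Proof.
elim: w i => [|g w IH] i; first by rewrite /cactus_word big_nil xpd1.
by rewrite /= IH /cactus_word big_cons xpdM xpd_gen posE.
Qed.

Lemma xpd_sgen n p i j : i < j < n ->
  [\/ j < p /\ xpd p (sgen n i j) = sgen n.+1 i j,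
      p < i /\ xpd p (sgen n i j) = sgen n.+1 i.+1 j.+1 |
      i <= p <= j /\ xpd p (sgen n i j) = sgen n.+1 p p.+1 * sgen n.+1 i j.+1].
Proof. by move=> h; rewrite sgenE xpd_gen; exact: (expand_gen_cases p (exist _ (i, j) h)). Qed.

Lemma pos_sgen n p i j : i < j < n -> pos p (sgen n i j) = flip i j p.
Proof. by move=> h; rewrite sgenE pos_gen. Qed.

Definition shift (p q : nat) : nat := if p < q then q.+1 else q.

Lemma expand_gen_comm n p q (g : cactus_index n) : p < q ->
  xpd q.+1 (expand_gen p g) = xpd p (expand_gen q g).
Proof.
case: g => -[j k] jk pq; have /= jkn := jk.
have h1 : j < k < n.+1 by lia.
have h2 : j.+1 < k.+1 < n.+1 by lia.
have h3 : j < k.+1 < n.+1 by lia.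
have P r : r <= k -> r < r.+1 < n.+1 by lia.
case: (expand_gen_cases p (exist _ (j, k) jk)) => -[/= ? ->];
case: (expand_gen_cases q (exist _ (j, k) jk)) => -[/= ? ->]; try lia;
rewrite ?xpdM ?pos_sgen //; try by apply: P; lia.
all: repeat match goal with
  | |- context [flip ?i ?j ?m] =>
    lazymatch m with context [flip] => fail | _ =>
      case: (flipP i j m) => -[? ->] /=; try (exfalso; lia) end
  | |- context [@xpd ?n ?p (sgen ?n ?i ?j)] =>
      case: (@xpd_sgen n p i j); [lia | | | ] => -[? ->]; try (exfalso; lia)
  end => //.
by rewrite !mulgA sgenC.
Qed.

Lemma pos_expand_gen n p q (g : cactus_index n) : p != q ->
  pos (shift p q) (expand_gen p g) =
  shift (flip (val g).1 (val g).2 p) (flip (val g).1 (val g).2 q).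
Proof.
case: g => -[j k] jk pq; have /= jkn := jk.
have P : p <= k -> p < p.+1 < n.+1 by lia.
rewrite /shift; case: (expand_gen_cases p (exist _ (j, k) jk)) => -[/= ? ->];
  rewrite ?posM ?pos_sgen; try lia; flips; do 2 case: ifP => ?; lia.
Qed.

Lemma xpd_comm n p q (s : cactus n) : p != q ->
  xpd (shift p q) (xpd p s) = xpd (shift q p) (xpd q s).
Proof.
elim/cactus_ind: s p q => [|g s IH] p q pq; first by rewrite !xpd1.
rewrite !xpdM !xpd_gen !pos_gen !pos_expand_gen //; last by rewrite eq_sym.
rewrite (IH (flip _ _ p) (flip _ _ q)) ?(inj_eq (can_inj (flipK _ _))) //.
congr (_ * _); rewrite /shift; case: (ltngtP p q) pq => // pq _.
  exact: expand_gen_comm.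
by symmetry; exact: expand_gen_comm.
Qed.

Lemma pos_xpd n p q (s : cactus n) : p != q ->
  pos (shift p q) (xpd p s) = shift (pos p s) (pos q s).
Proof.
elim/cactus_ind: s p q => [|g s IH] p q pq; first by rewrite !xpd1 !pos1.
rewrite !xpdM !xpd_gen !posM !pos_gen pos_expand_gen // IH //.
by rewrite (inj_eq (can_inj (flipK _ _))).
Qed.

Lemma pos_inj n (s : cactus n) p q : pos p s = pos q s -> p = q.
Proof. by move=> e; rewrite -(posK p s) e posK. Qed.

Fixpoint tle (t u : tree) : bool :=
  match t, u with
  | Leaf, _ => true
  | Node a b, Node c d => tle a c && tle b d
  | _, _ => false
  end.

Lemma leaves_gt0 t : 0 < leaves t.
Proof. by elim: t => //= l; lia. Qed.

Lemma tle_refl t : tle t t.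
Proof. by elim: t => //= l -> r ->. Qed.

Lemma tle_trans t u v : tle t u -> tle u v -> tle t v.
Proof.
elim: t u v => //= a IHa b IHb [|c d] [|e f] //= /andP[ac bd] /andP[ce df].
by rewrite (IHa c e) // (IHb d f).
Qed.

Lemma tle_attach t i : tle t (attach t i).
Proof. by elim: t i => //= l IHl r IHr i; case: ifP => _ /=; rewrite ?IHl ?IHr ?tle_refl. Qed.

Lemma tle_leaves t u : tle t u -> leaves t <= leaves u /\ (leaves t = leaves u -> t = u).
Proof.
elim: t u => [|a IHa b IHb] [|c d] //=.
- by move=> _; have := leaves_gt0 c; have := leaves_gt0 d; lia.
- move=> /andP[/IHa[ac Eac] /IHb[bd Ebd]]; split; first lia.
  by move=> e; congr Node; [apply: Eac|apply: Ebd]; lia.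
Qed.

Lemma tle_step t u : tle t u -> leaves t < leaves u ->
  exists2 i, i < leaves t & tle (attach t i) u.
Proof.
elim: t u => [|a IHa b IHb] [|c d] //=; first by exists 0.
move=> /andP[ac bd] lt.
have [lt1|ge1] := ltnP (leaves a) (leaves c).
  by have [i ia ?] := IHa _ ac lt1; exists i; [lia|rewrite ia /=; apply/andP].
have [|i ib ?] := IHb _ bd; first by have [] := tle_leaves ac; lia.
exists (leaves a + i)%N; first by lia.
by rewrite ltnNge leq_addr /= addKn; apply/andP.
Qed.

Lemma tle_join t u : exists v, tle t v /\ tle u v.
Proof.
elim: t u => [|a IHa b IHb] u; first by exists u; rewrite tle_refl.
case: u => [|c d]; first by exists (Node a b); rewrite tle_refl.
have [v [av cv]] := IHa c; have [w [bw dw]] := IHb d.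
by exists (Node v w); rewrite /= av cv bw dw.
Qed.

Lemma attach_shift t i j : i != j -> i < leaves t -> j < leaves t ->
  attach (attach t i) (shift i j) = attach (attach t j) (shift j i).
Proof.
elim: t i j => [|l IHl r IHr] i j /=; first by lia.
move=> ij il jl; have [il'|il'] := ltnP i (leaves l); have [jl'|jl'] := ltnP j (leaves l) => /=.
- have h1 : shift i j < (leaves l).+1 by rewrite /shift; case: ifP; lia.
  have h2 : shift j i < (leaves l).+1 by rewrite /shift; case: ifP; lia.
  by rewrite !leaves_attach h1 h2 IHl.
- have -> : shift i j = j.+1 by rewrite /shift; case: ifP; lia.
  have -> : shift j i = i by rewrite /shift; case: ifP; lia.
  by rewrite leaves_attach il' ltnNge ltnS jl' /= subSS.
- have -> : shift i j = j by rewrite /shift; case: ifP; lia.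
  have -> : shift j i = i.+1 by rewrite /shift; case: ifP; lia.
  by rewrite leaves_attach jl' ltnNge ltnS il' /= subSS.
- have -> : (shift i j < leaves l) = false by rewrite /shift; case: ifP; lia.
  have -> : (shift j i < leaves l) = false by rewrite /shift; case: ifP; lia.
  congr Node.
  have e a b : leaves l <= a -> leaves l <= b ->
      (shift a b - leaves l)%N = shift (a - leaves l) (b - leaves l).
    by rewrite /shift; do 2 case: ifP; lia.
  by rewrite !e // IHr //; lia.
Qed.

Lemma tle_attach2 t u i j : i != j -> i < leaves t -> j < leaves t ->
  tle (attach t i) u -> tle (attach t j) u -> tle (attach (attach t i) (shift i j)) u.
Proof.
elim: t u i j => [|l IHl r IHr] [|c d] i j //=; try lia.
  by case: ifP.
move=> ij il jl; have [il'|il'] := ltnP i (leaves l); have [jl'|jl'] := ltnP j (leaves l) => /=.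
- move=> /andP[ac rd] /andP[ac' _]; rewrite leaves_attach ifT /=; last by rewrite /shift; case: ifP; lia.
  by rewrite IHl.
- move=> /andP[ac rd] /andP[ac' rd'].
  have -> : shift i j = j.+1 by rewrite /shift; case: ifP; lia.
  by rewrite leaves_attach ltnNge ltnS jl' /= subSS ac.
- move=> /andP[ac rd] /andP[ac' rd'].
  have -> : shift i j = j by rewrite /shift; case: ifP; lia.
  by rewrite jl' /= ac' rd.
- move=> /andP[ac rd] /andP[ac' rd']; rewrite ifF /=; last by rewrite /shift; case: ifP; lia.
  have -> : (shift i j - leaves l)%N = shift (i - leaves l) (j - leaves l).
    by rewrite /shift; do 2 case: ifP; lia.
  by rewrite ac IHr //; lia.
Qed.

Definition triple (n : nat) := (ntree n * cactus n * ntree n)%type.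

Definition expand_triple n (c : triple n) (i : 'I_n) : triple n.+1 :=
  (nattach c.1.1 i, xpd i c.1.2, nattach c.2 (cactus_perm c.1.2 i)).

Definition expand (x : cactus_tree_pair) (i : 'I_(tag x)) : cactus_tree_pair :=
  Tagged triple (expand_triple (tagged x) i).

Lemma expansionP x y : expansion x y <-> exists i, y = expand (x := x) i.
Proof.
split=> [[n Tp Tm w i]|[i ->]]; first by exists i; rewrite /expand /expand_triple /= -expand_wordE.
case: x i => n [[Tp s] Tm] i; have [w e] := cactus_wordP s.
rewrite /expand /expand_triple /= e -expand_wordE; exact: Expansion.
Qed.

Definition topt (x : cactus_tree_pair) : tree := val (tagged x).1.1.
Definition bott (x : cactus_tree_pair) : tree := val (tagged x).2.

Lemma leaves_topt x : leaves (topt x) = tag x.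
Proof. exact: (eqP (valP (tagged x).1.1)). Qed.

Lemma leaves_bott x : leaves (bott x) = tag x.
Proof. exact: (eqP (valP (tagged x).2)). Qed.

Inductive star (x : cactus_tree_pair) : cactus_tree_pair -> Prop :=
| Star0 : star x x
| StarS y i : star x y -> star x (expand (x := y) i).

Lemma star_trans x y z : star x y -> star y z -> star x z.
Proof. by move=> xy; elim=> // {}z i _; exact: StarS. Qed.

Lemma star_expand x i : star x (expand (x := x) i).
Proof. exact/StarS/Star0. Qed.

Lemma star_front x y : star x y -> x = y \/ exists i, star (expand (x := x) i) y.
Proof.
elim=> [|{}y i _ [e|[j xy]]]; [by left|right|right].
  by subst y; exists i; exact: Star0.
by exists j; exact: StarS.
Qed.

Lemma expand_comm x (i j : 'I_(tag x)) : i != j ->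
  exists i' j', [/\ expand (x := expand i) j' = expand (x := expand j) i',
    val j' = shift i j & val i' = shift j i].
Proof.
move=> ij.
have ltS (a b : 'I_(tag x)) : shift a b < (tag x).+1.
  by case: a b => a la [b lb]; rewrite /shift /=; case: ifP; lia.
exists (Ordinal (ltS j i)), (Ordinal (ltS i j)); split=> //.
case: x i j ij ltS => n [[Tp s] Tm] /= i j ij ltS.
have Dtp : leaves (val Tp) = n := eqP (valP Tp).
have Dtm : leaves (val Tm) = n := eqP (valP Tm).
have pij : cactus_perm s i != cactus_perm s j by rewrite (inj_eq perm_inj).
rewrite /expand; congr Tagged; rewrite /expand_triple /=; congr (_, _, _).
- by apply: val_inj; rewrite /= attach_shift ?Dtp.
- exact: xpd_comm.
- apply: val_inj; rewrite /= !posE /= !pos_xpd ?(eq_sym (val j)) //.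
  by rewrite -!posE attach_shift ?Dtm.
Qed.

Lemma expand_diamond x i j : expand (x := x) i = expand (x := x) j \/
  exists i' j', expand (x := expand (x := x) i) j' = expand (x := expand (x := x) j) i'.
Proof.
have [->|ij] := eqVneq i j; first by left.
by right; have [i' [j' [? _ _]]] := expand_comm ij; exists i', j'.
Qed.

Lemma expand_strip x i y : star x y -> exists z, star (expand (x := x) i) z /\
  (z = y \/ exists j, z = expand (x := y) j).
Proof.
elim=> [|{}y j _ [z [iz [e|[k e]]]]]; try subst z.
- by exists (expand i); split; [exact: Star0 | right; exists i].
- by exists (expand j); split; [exact: StarS | left].
- have [e|[i' [j' e]]] := expand_diamond k j.
    by exists (expand j); split; [rewrite -e | left].
  by exists (expand j'); split; [exact: StarS | right; exists i'].
Qed.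

Lemma star_confluent x y z : star x y -> star x z -> exists w, star y w /\ star z w.
Proof.
move=> xy; elim=> [|{}z i _ [w [yw zw]]]; first by exists y; split => //; exact: Star0.
have [v [iv [e|[j e]]]] := expand_strip i zw.
  by exists w; rewrite -{2}e.
by exists v; split => //; apply: star_trans yw _; rewrite e; exact: star_expand.
Qed.

Lemma ctp_equivP x y : ctp_equiv x y -> exists z, star x z /\ star y z.
Proof.
elim=> {x y} [x y /expansionP[i ->]|x|x y _ [z [xz yz]]|x y z _ [u [xu yu]] _ [v [yv zv]]].
- by exists (expand i); split; [exact: star_expand | exact: Star0].
- by exists x; split; exact: Star0.
- by exists z.
- have [w [uw vw]] := star_confluent yu yv.
  by exists w; split; [exact: star_trans uw | exact: star_trans vw].
Qed.

Lemma star_equiv x y : star x y -> ctp_equiv x y.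
Proof.
elim=> [|{}y i _ xy]; first exact: rst_refl.
by apply: rst_trans xy (rst_step _ _ _ _ _); apply/expansionP; exists i.
Qed.

Lemma star_tle x y : star x y -> tle (topt x) (topt y).
Proof. by elim=> [|{}y i _ h]; [exact: tle_refl | exact: tle_trans h (tle_attach _ _)]. Qed.

Lemma star_reach x u : tle (topt x) u -> exists y, star x y /\ topt y = u.
Proof.
have [m le_m] := ubnP (leaves u - tag x).
elim: m x le_m => // m IH x le_m xu.
have [le_x eq_x] := tle_leaves xu; rewrite leaves_topt in le_x eq_x.
have [lt|ge] := ltnP (tag x) (leaves u); last first.
  by exists x; split; [exact: Star0|apply: eq_x; lia].
have [|i iu iu'] := tle_step xu; first by rewrite leaves_topt.
have itx : i < tag x by rewrite -leaves_topt.
have [|y [xy yu]] := IH (expand (Ordinal itx)) _ iu'; first by rewrite /=; lia.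
by exists y; split => //; apply: star_trans xy; exact: star_expand.
Qed.

Lemma star_tag x y : star x y -> tag x <= tag y.
Proof. by elim=> [//|{}y i _ /= h]; exact: leq_trans h _. Qed.

Lemma star_unique x y z : star x y -> star x z -> topt y = topt z -> y = z.
Proof.
have [m] := ubnP (tag y - tag x).
elim: m x y z => // m IH x y z le_m xy xz yz.
have eyz : tag y = tag z by rewrite -!leaves_topt yz.
have [e|[i iy]] := star_front xy.
  subst y; have [//|[j jz]] := star_front xz.
  by have := star_tag jz; rewrite /= -eyz ltnn.
have [e|[j jz]] := star_front xz.
  by subst z; have := star_tag iy; rewrite /= eyz ltnn.
have iy_tag := star_tag iy; have jz_tag := star_tag jz; rewrite /= in iy_tag jz_tag.
have [e|ij] := eqVneq i j.
  by subst j; apply: (IH (expand i)) => //=; lia.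
have [i' [j' [e ej' ei']]] := expand_comm ij.
have le_top : tle (topt (expand j')) (topt y).
  change (tle (attach (attach (topt x) i) j') (topt y)); rewrite ej'.
  apply: tle_attach2; rewrite ?leaves_topt //.
    exact: (star_tle iy).
  by rewrite yz; exact: (star_tle jz).
have [w [jw wy]] := star_reach le_top.
have -> : y = w.
  apply: (IH (expand i)) => //=; first by lia.
  by apply: star_trans jw; exact: star_expand.
apply: (IH (expand j)) => //=; last by rewrite wy.
  by rewrite -leaves_topt wy leaves_topt; lia.
by apply: star_trans jw; rewrite e; exact: star_expand.
Qed.

Definition inv_ctp (x : cactus_tree_pair) : cactus_tree_pair :=
  let: (Tp, s, Tm) := tagged x in ctp Tm s^-1 Tp.

Lemma inv_ctpK : involutive inv_ctp.
Proof. by case=> n [[Tp s] Tm]; rewrite /inv_ctp /= invgK. Qed.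

Lemma topt_inv x : topt (inv_ctp x) = bott x.
Proof. by case: x => n [[Tp s] Tm]. Qed.

Lemma bott_inv x : bott (inv_ctp x) = topt x.
Proof. by case: x => n [[Tp s] Tm]. Qed.

Lemma inv_expand x i : exists j, inv_ctp (expand (x := x) i) = expand (x := inv_ctp x) j.
Proof.
case: x i => n [[Tp s] Tm] i; exists (cactus_perm s i).
rewrite /inv_ctp /expand /expand_triple /ctp /=; congr Tagged; congr (_, _, _).
  by rewrite posE xpdV.
by congr nattach; apply: val_inj; rewrite /= !posE posK.
Qed.

Lemma inv_star x y : star x y -> star (inv_ctp x) (inv_ctp y).
Proof.
elim=> [|{}y i _ xy]; first exact: Star0.
by have [j ->] := inv_expand i; exact: StarS.
Qed.

Lemma inv_equiv x y : ctp_equiv x y -> ctp_equiv (inv_ctp x) (inv_ctp y).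
Proof.
move=> /ctp_equivP[z [/inv_star/star_equiv xz /inv_star/star_equiv yz]].
exact/(rst_trans _ _ _ _ _ xz)/rst_sym.
Qed.

Lemma star_unique_bot x y z : star x y -> star x z -> bott y = bott z -> y = z.
Proof.
move=> /inv_star xy /inv_star xz e; apply: (can_inj inv_ctpK).
by apply: star_unique xy xz _; rewrite !topt_inv.
Qed.

Inductive ctp_product : cactus_tree_pair -> cactus_tree_pair -> cactus_tree_pair -> Prop :=
| CtpProduct n (Sp Sm Tm : ntree n) (s t : cactus n) :
    ctp_product (ctp Sp s Sm) (ctp Sm t Tm) (ctp Sp (s * t) Tm).

Lemma ctp_product_exists x y : bott x = topt y -> exists z, ctp_product x y z.
Proof.
case: x y => n [[Sp s] Sm] [m [[Tp t] Tm]]; rewrite /bott /topt /= => e.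
have enm : n = m.
  exact: etrans (esym (eqP (valP Sm))) (etrans (congr1 leaves e) (eqP (valP Tp))).
subst m; move/val_inj: e => e; subst Tp.
by exists (ctp Sp (s * t) Tm); exact: CtpProduct.
Qed.

Lemma ctp_product_invl n (A B : ntree n) (s : cactus n) y z :
  ctp_product (ctp A s B) y z ->
  exists t C, y = ctp B t C /\ z = ctp A (s * t) C.
Proof.
move e : (ctp A s B) => x p.
case: p e => m Sp Sm Tm s' t e; have enm : n = m := congr1 tag e.
subst m; move/eqP: e; rewrite /ctp eq_Tagged /= => /eqP[-> -> ->].
by exists t, Tm.
Qed.

Lemma ctp_product_fun x y z z' : ctp_product x y z -> ctp_product x y z' -> z = z'.
Proof.
case=> n Sp Sm Tm s t /ctp_product_invl[t' [C [/eqP + ->]]].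
by rewrite /ctp eq_Tagged /= => /eqP[-> ->].
Qed.

Lemma ctp_product_bott x y z : ctp_product x y z -> bott x = topt y.
Proof. by case. Qed.

Lemma ctp_product_inv x y z :
  ctp_product x y z -> ctp_product (inv_ctp y) (inv_ctp x) (inv_ctp z).
Proof. by case=> n Sp Sm Tm s t; rewrite /inv_ctp /= invgM; exact: CtpProduct. Qed.

Lemma ctp_product_expand x y z (i : 'I_(tag x)) : ctp_product x y z -> exists j k,
  ctp_product (expand (x := x) i) (expand (x := y) j) (expand (x := z) k).
Proof.
move=> p; case: p i => n Sp Sm Tm s t i.
exists (cactus_perm s i), i.
rewrite /expand /expand_triple /= xpdM cactus_permM permM -posE.
exact: CtpProduct.
Qed.

Lemma ctp_product_starl x y z x' : ctp_product x y z -> star x x' ->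
  exists y' z', [/\ star y y', star z z' & ctp_product x' y' z'].
Proof.
move=> p; elim=> [|{}x' i _ [y' [z' [yy zz p']]]].
  by exists y, z; split => //; exact: Star0.
have [j [k q]] := ctp_product_expand i p'.
by exists (expand j), (expand k); split => //; exact: StarS.
Qed.

Lemma ctp_product_starr x y z y' : ctp_product x y z -> star y y' ->
  exists x' z', [/\ star x x', star z z' & ctp_product x' y' z'].
Proof.
move=> /ctp_product_inv p /inv_star yy.
have [x' [z' [/inv_star + /inv_star + /ctp_product_inv]]] := ctp_product_starl p yy.
by rewrite !inv_ctpK; exists (inv_ctp x'), (inv_ctp z').
Qed.

Lemma ctp_product_stare x y z z' : ctp_product x y z -> star z z' ->
  exists x' y', [/\ star x x', star y y' & ctp_product x' y' z'].
Proof.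
move=> p; elim=> [|{}z' k _ [x' [y' [xx yy p']]]].
  by exists x, y; split => //; exact: Star0.
have: exists i j, ctp_product (expand (x := x') i) (expand (x := y') j) (expand (x := z') k).
  case: p' k => n Sp Sm Tm s t k; exists k, (cactus_perm s k).
  rewrite /expand /expand_triple /= xpdM cactus_permM permM -posE; exact: CtpProduct.
by move=> [i [j q]]; exists (expand i), (expand j); split => //; exact: StarS.
Qed.

Lemma ctp_product_refine x y : exists x' y' z',
  [/\ star x x', star y y' & ctp_product x' y' z'].
Proof.
have [u [xu yu]] := tle_join (bott x) (topt y).
have [y' [yy e]] := star_reach yu.
have [|x' [xx e']] := @star_reach (inv_ctp x) u; first by rewrite topt_inv.
have [|z p] := @ctp_product_exists (inv_ctp x') y'; first by rewrite bott_inv e'.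
by exists (inv_ctp x'), y', z; split => //; rewrite -[x]inv_ctpK; exact: inv_star.
Qed.

Lemma ctp_product_equiv x1 y1 z1 x2 y2 z2 :
  ctp_product x1 y1 z1 -> ctp_product x2 y2 z2 ->
  ctp_equiv x1 x2 -> ctp_equiv y1 y2 -> ctp_equiv z1 z2.
Proof.
move=> p1 p2 /ctp_equivP[x [x1x x2x]] y12.
have [y1' [z1' [yy1 zz1 q1]]] := ctp_product_starl p1 x1x.
have [y2' [z2' [yy2 zz2 q2]]] := ctp_product_starl p2 x2x.
have /ctp_equivP[y [y1y y2y]] : ctp_equiv y1' y2'.
  apply: rst_trans (rst_trans _ _ _ _ _ y12 (star_equiv yy2)).
  exact/rst_sym/star_equiv.
have [x1' [w1 [xx1 zw1 r1]]] := ctp_product_starr q1 y1y.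
have [x2' [w2 [xx2 zw2 r2]]] := ctp_product_starr q2 y2y.
have e : x1' = x2'.
  by apply: star_unique_bot xx1 xx2 _; rewrite (ctp_product_bott r1) (ctp_product_bott r2).
subst x2'; have e := ctp_product_fun r1 r2; subst w2.
apply: (rst_trans _ _ _ w1); first exact/star_equiv/(star_trans zz1).
exact/rst_sym/star_equiv/(star_trans zz2).
Qed.

Definition ctp_equivb : rel cactus_tree_pair := fun x y => `[< ctp_equiv x y >].

Lemma ctp_equiv_class : equiv_class_of ctp_equivb.
Proof.
split.
- by move=> u; apply/asboolP/rst_refl.
- move=> u v; apply/asboolP/asboolP; exact: rst_sym.
- by move=> v u w /asboolP uv /asboolP vw; apply/asboolP/(rst_trans _ _ _ _ _ uv).
Qed.

Canonical ctp_equiv_rel := EquivRelPack ctp_equiv_class.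

Definition CV := {eq_quot ctp_equivb}.
HB.instance Definition _ : EqQuotient _ ctp_equivb CV := EqQuotient.on CV.
HB.instance Definition _ := Choice.on CV.

Definition CV_class (x : cactus_tree_pair) : CV := \pi_CV x.

Definition leaf_tree : ntree 1 := exist _ Leaf (eqxx 1%N).

Definition CV_one : CV := CV_class (ctp leaf_tree 1 leaf_tree).

(* By ctp_product_refine and ctp_product_equiv exactly one class c qualifies, *)
(* so the default CV_one plays no role; see CV_mulE.                          *)
Definition CV_mul (a b : CV) : CV :=
  xget CV_one [set c | exists x y z, [/\ ctp_product x y z,
    CV_class x = a, CV_class y = b & CV_class z = c]].

Definition CV_inv (a : CV) : CV := CV_class (inv_ctp (repr a)).

Lemma CV_classP x y : ctp_equiv x y <-> CV_class x = CV_class y.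
Proof.
split=> [xy|/eqmodP/asboolP //].
by rewrite /CV_class; apply/eqmodP/asboolP.
Qed.

Lemma CV_class_star x y : star x y -> CV_class x = CV_class y.
Proof. by move=> /star_equiv/CV_classP. Qed.

Lemma CV_reprK a : CV_class (repr a) = a.
Proof. exact: reprK. Qed.

Lemma CV_mulE x y z : ctp_product x y z ->
  CV_mul (CV_class x) (CV_class y) = CV_class z.
Proof.
move=> p; rewrite /CV_mul; case: xgetP => [c -> [x' [y' [z' [p' /CV_classP ex /CV_classP ey <-]]]]|].
  exact/CV_classP/(ctp_product_equiv p' p).
by move/(_ (CV_class z)); case; exists x, y, z.
Qed.

Lemma CV_invE n (Tp Tm : ntree n) (s : cactus n) :
  CV_inv (CV_class (ctp Tp s Tm)) = CV_class (ctp Tm s^-1 Tp).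
Proof.
rewrite /CV_inv; apply/CV_classP/(@inv_equiv _ (ctp Tp s Tm))/CV_classP.
exact: CV_reprK.
Qed.

Lemma star_one x y : star x y ->
  (tagged x).1.2 = 1 /\ (tagged x).1.1 = (tagged x).2 ->
  (tagged y).1.2 = 1 /\ (tagged y).1.1 = (tagged y).2.
Proof.
move=> xy x1; elim: xy => // {}y i _.
case: y i => n [[Tp s] Tm] /= i [-> ->].
by rewrite xpd1 cactus_perm1 perm1.
Qed.

Lemma CV_oneE n (T : ntree n) : CV_class (ctp T 1 T) = CV_one.
Proof.
have [//|y [oy e]] := @star_reach (ctp leaf_tree 1 leaf_tree) (val T).
rewrite /CV_one (CV_class_star oy); congr CV_class.
have [] := star_one oy (conj erefl erefl).
case: y oy e => m [[Tp s] Tm] _; rewrite /topt /= => e -> <-.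
have enm : n = m.
  exact: etrans (esym (eqP (valP T))) (etrans (congr1 leaves (esym e)) (eqP (valP Tp))).
by subst m; rewrite (val_inj e : Tp = T).
Qed.

Lemma CV_mulA : associative CV_mul.
Proof.
move=> a b c; rewrite -[a]CV_reprK -[b]CV_reprK -[c]CV_reprK.
move: (repr a) (repr b) (repr c) => {a b c} x y z.
have [x1 [y1 [xy1 [xx1 yy1 p]]]] := ctp_product_refine x y.
have [xy2 [z2 [v [xy12 zz2 q]]]] := ctp_product_refine xy1 z.
have [x2 [y2 [x12 y12 p2]]] := ctp_product_stare p xy12.
have xx2 := star_trans xx1 x12; have yy2 := star_trans yy1 y12.
rewrite (CV_class_star xx2) (CV_class_star yy2) (CV_class_star zz2).
case: p2 q => n Sp Sm Tm s t /ctp_product_invl[u [C [-> _]]].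
by rewrite !(CV_mulE (CtpProduct _ _ _ _ _)) mulgA.
Qed.

Lemma CV_mul1 : left_id CV_one CV_mul.
Proof.
move=> a; rewrite -[a]CV_reprK; case: (repr a) => n [[Tp s] Tm].
by rewrite -(CV_oneE Tp) (CV_mulE (CtpProduct _ _ _ _ _)) mul1g.
Qed.

Lemma CV_1mul : right_id CV_one CV_mul.
Proof.
move=> a; rewrite -[a]CV_reprK; case: (repr a) => n [[Tp s] Tm].
by rewrite -(CV_oneE Tm) (CV_mulE (CtpProduct _ _ _ _ _)) mulg1.
Qed.

Lemma CV_mulV : left_inverse CV_one CV_inv CV_mul.
Proof.
move=> a; rewrite -[a]CV_reprK; case: (repr a) => n [[Tp s] Tm].
by rewrite CV_invE (CV_mulE (CtpProduct _ _ _ _ _)) mulVg CV_oneE.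
Qed.

Lemma CV_mulVr : right_inverse CV_one CV_inv CV_mul.
Proof.
move=> a; rewrite -[a]CV_reprK; case: (repr a) => n [[Tp s] Tm].
by rewrite CV_invE (CV_mulE (CtpProduct _ _ _ _ _)) mulgV CV_oneE.
Qed.

HB.instance Definition _ := isGroup.Build CV
  CV_mulA CV_mul1 CV_1mul CV_mulV CV_mulVr.

(* Main.v *)
From Stdlib Require Import Relation_Operators.
Require Import Defs.
From HB Require Import structures.
From mathcomp Require Import all_boot all_fingroup.
From mathcomp Require Import generic_quotient boolp zify.

Set Implicit Arguments.
Unset Strict Implicit.
Unset Printing Implicit Defensive.

Local Open Scope group_scope.

(** Write R_n for the right comb with n leaves, numbered from 0.  Two kinds of
    elements generate CV: for p < n the element X(n,p) = [R_n + p, 1, R_(n+1)],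
    where R_n + p is R_n with a caret attached to leaf p, and for i <= j < n the
    element S(n,i,j) = [R_n, s_(i,j), R_n].  Indeed [T, s, U] is the product of
    [T, 1, R_n], [R_n, s, R_n] and [R_n, 1, U], and [T, 1, R_n] is a product of
    elements X(m,p), one for each caret of T.  The relations X(n,n-1) = 1, the
    commutation of two attachments of carets, the cactus relations on each R_n,
    and the rule
      S(n,i,j) X(n,q) = X(n,p) S(s'),   q the image of p under s_(i,j),
    where s' is the expansion of s_(i,j) at p, present CV: they are what is needed
    for sending [T, s, U] to (carets of T) S(s) (carets of U)^-1 to be well
    defined (pair_elt_expand) and multiplicative (CV_homM).

    Finitely many of them imply the others, for two reasons.

    - Position.  X(n,p) does not depend on n as long as p is not the last leaf,
      and conjugation by X(2,0) moves every element supported away from leaf 0 one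
      leaf to the right; the same holds for c(n,p) = S(n,p,p+1), which has an
      interior version and a version at the last two leaves.  Six generators
      suffice therefore, and a relation valid in positions 0 and 1, at the right
      end and off it, is valid everywhere (famC, fam_far, low_ind), as a classical
      argument shows for Thompson's group F.

    - Width.  The rule above, applied to a leaf p inside the interval, reads
      S(n,i,j) X(n,q) = X(n,p) c(n+1,p) S(n+1,i,j+1) with q = i+j-p.  Taking p = i
      it defines the flips of all widths from X and c.  That every other p gives
      the same element is a diamond argument: two leaves which are not adjacent
      can be merged one after the other in either order (splits_diamond), and
      adjacent ones are compared through a third leaf, which exists as soon as the
      interval is long enough (comb_S_splits).  In the same way the relation
      between a flip and a shorter flip of two adjacent leaves follows, by merging
      two leaves far from those, from the one for narrower flips (comb_S_nest2).
      Both arguments start from relations of width at most 3.  The remaining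
      cactus relations are formal consequences: s_(i,j) is an involution because
      the rule at p, read from the left and from the right, gives inverse
      factorizations (comb_SK), and nested flips are treated by induction on the
      width of the inner one (comb_S_nest). *)

(** * Commutation squares in a group *)

(* An equation a * b = c * d is a commutation square; it is used below inside
   products associated to the left, also with one or both pairs of opposite sides
   traversed backwards. *)

Section Squares.
Variable G : groupType.
Implicit Types a b c d x : G.

Lemma mulg_sq a b c d : a * b = c * d -> forall x, x * a * b = x * c * d.
Proof. by move=> h x; rewrite -!mulgA h. Qed.

Lemma mulg_sqV a b c d : a * b = c * d -> forall x, x * c^-1 * a = x * d * b^-1.
Proof. by move=> h x; rewrite -(mulgK b a) h -!mulgA mulKg. Qed.

Lemma mulg_sqVV a b c d : a * b = c * d -> forall x, x * b^-1 * a^-1 = x * d^-1 * c^-1.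
Proof. by move=> h x; rewrite -!mulgA -!invgM h. Qed.

Lemma conj_sq a b d : a ^ b = d <-> a * b = b * d.
Proof. by rewrite conjgE; split=> [<-|->]; rewrite ?mulVKg ?mulKg. Qed.

End Squares.

(** * The generators and the finite list of relations *)

Definition holds (G : groupType) (s : seq (G * G)) := {in s, forall r, r.1 = r.2}.

Lemma holds_cat (G : groupType) (s t : seq (G * G)) :
  holds (s ++ t) <-> holds s /\ holds t.
Proof.
split=> [h|[hs ht] r]; last by rewrite mem_cat => /orP[/hs|/ht].
by split=> r hr; apply: h; rewrite mem_cat hr ?orbT.
Qed.

Section Families.
Variables (G : groupType) (a : 'I_6 -> G).

(** For k = 0, 2, 4 the generators a_k and a_(k+1) are the members at the leaves 0
    and 1 of a family that conjugation by a_0 continues to the right: the carets X,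
    the flips of two adjacent leaves off the right end, and the flips of the last
    two leaves. *)
Definition fam (k p : nat) : G :=
  if p is p'.+1 then iter p' (fun g => g ^ a (inord 0)) (a (inord k.+1))
  else a (inord k).

(** A caret attached to the last leaf of a right comb gives a right comb, whence
    the value 1. *)
Definition comb_X (n p : nat) : G := if p.+1 < n then fam 0 p else 1.

Definition comb_c (n p : nat) : G := if p.+2 < n then fam 2 p else fam 4 p.

(** The flip of the leaves i, ..., i + w of the comb with n leaves.  Expanding the
    flip of width w' on the comb with one leaf less at its first leaf i gives the
    flip of the caret attached there, followed by the flip of width w'.+1; the
    factor c cancels the former. *)
Fixpoint comb_S_rec (w n i : nat) : G :=
  if w is w'.+1 then
    comb_c n i * (comb_X n.-1 i)^-1 * comb_S_rec w' n.-1 i * comb_X n.-1 (i + w')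
  else 1.

End Families.

(** Locking keeps rewriting rules about products from seeing the product that a
    flip of positive width unfolds to. *)
HB.lock Definition comb_S (G : groupType) (a : 'I_6 -> G) := comb_S_rec a.

Section Relations.
Variables (G : groupType) (a : 'I_6 -> G).

Local Notation fam := (fam a).
Local Notation comb_X := (comb_X a).
Local Notation comb_c := (comb_c a).
Local Notation comb_S := (comb_S a).

(** Carets attached to leaf 1 shift the elements on the right of leaf 1. *)
Definition shift_rel k q := (fam k q ^ fam 0 1%N, fam k q.+1).

Definition far_rel k i q := (fam 2 i * fam k q, fam k q * fam 2 i).

Definition invol_rel k i := (fam k i * fam k i, 1 : G).

(** Expansion of the flip of the leaves i, ..., i + w at its k-th leaf. *)
Definition expand_rel w k i n :=
  (comb_S w n i * comb_X n (i + w - k),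
   comb_X n (i + k) * comb_c n.+1 (i + k) * comb_S w.+1 n.+1 i).

(** Cactus relation between the flip of the leaves i, ..., i + w and the flip of
    its k-th and (k+1)-st leaves. *)
Definition nest_rel w k i n :=
  (comb_S w n i * comb_c n (i + k), comb_c n (i + w - k.+1) * comb_S w n i).

(** The pair (i, b) stands for an interval that starts at leaf i and leaves b
    leaves on its right; conjugation by carets reduces all other pairs to these. *)
Definition positions := [:: (0, 0); (0, 1); (1, 0); (1, 1)]%N.

Definition shift_rels := [seq shift_rel k q | k <- [:: 0; 2; 4], q <- [:: 2; 3]].

Definition far_rels :=
  [seq far_rel k t.1 (t.1 + t.2) | k <- [:: 0; 2; 4],
     t <- [:: (0, 2); (0, 3); (1, 2); (1, 3)]%N].

Definition invol_rels := [seq invol_rel k i | k <- [:: 2; 4], i <- [:: 0; 1]%N].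

Definition expand_rels :=
  [seq expand_rel t.1 t.2 p.1 (p.1 + t.1 + p.2).+1 |
     t <- [:: (1, 1); (2, 1); (2, 2)]%N, p <- positions].

Definition nest_rels :=
  [seq nest_rel t.1 t.2 p.1 (p.1 + t.1 + p.2).+1 |
     t <- [:: (2, 0); (2, 1); (3, 1)]%N, p <- positions].

Definition relations : seq (G * G) :=
  shift_rels ++ far_rels ++ invol_rels ++ expand_rels ++ nest_rels.

Lemma relations_holds : holds relations ->
  [/\ holds shift_rels, holds far_rels, holds invol_rels,
      holds expand_rels & holds nest_rels].
Proof.
by move=> /holds_cat[h1 /holds_cat[h2 /holds_cat[h3 /holds_cat[h4 h5]]]].
Qed.

End Relations.

(** * Relations between carets and flips of two leaves *)

Section Theory.
Variables (G : groupType) (a : 'I_6 -> G).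
Hypothesis sat : holds (relations a).

Local Notation fam := (fam a).
Local Notation X := (comb_X a).
Local Notation c := (comb_c a).
Local Notation S := (comb_S a).

Let sat_shift k q : k \in [:: 0; 2; 4] -> q \in [:: 2; 3] -> fam k q ^ fam 0 1%N = fam k q.+1.
Proof.
move=> kI qI; have [h _ _ _ _] := relations_holds sat.
exact: (h _ (allpairs_f (shift_rel a) kI qI)).
Qed.

Let sat_far k i d : k \in [:: 0; 2; 4] -> (i, d) \in [:: (0, 2); (0, 3); (1, 2); (1, 3)]%N ->
  fam 2 i * fam k (i + d) = fam k (i + d) * fam 2 i.
Proof.
move=> kI iI; have [_ h _ _ _] := relations_holds sat.
exact: (h _ (allpairs_f (fun k t => far_rel a k t.1 (t.1 + t.2)) kI iI)).
Qed.

Let sat_invol k i : k \in [:: 2; 4] -> i \in [:: 0; 1]%N -> fam k i * fam k i = 1.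
Proof.
move=> kI iI; have [_ _ h _ _] := relations_holds sat.
exact: (h _ (allpairs_f (invol_rel a) kI iI)).
Qed.

Let mem_positions i b : i < 2 -> b < 2 -> (i, b) \in positions.
Proof. by case: i b => [|[|]] // [|[|]]. Qed.

Let sat_expand w k i b :
  (w, k) \in [:: (1, 1); (2, 1); (2, 2)]%N -> i < 2 -> b < 2 ->
  let n := (i + w + b).+1 in
  S w n i * X n (i + w - k) = X n (i + k) * c n.+1 (i + k) * S w.+1 n.+1 i.
Proof.
move=> wk i2 b2; have [_ _ _ h _] := relations_holds sat.
exact: (h _ (allpairs_f (fun t p => expand_rel a t.1 t.2 p.1 (p.1 + t.1 + p.2).+1)
  wk (mem_positions i2 b2))).
Qed.

Let sat_nest w k i b :
  (w, k) \in [:: (2, 0); (2, 1); (3, 1)]%N -> i < 2 -> b < 2 ->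
  let n := (i + w + b).+1 in
  S w n i * c n (i + k) = c n (i + w - k.+1) * S w n i.
Proof.
move=> wk i2 b2; have [_ _ _ _ h] := relations_holds sat.
exact: (h _ (allpairs_f (fun t p => nest_rel a t.1 t.2 p.1 (p.1 + t.1 + p.2).+1)
  wk (mem_positions i2 b2))).
Qed.

Lemma famS k p : fam k p.+2 = fam k p.+1 ^ fam 0 0.
Proof. by []. Qed.

(** Strong induction on q: conjugating g_(q+1) = g_q ^ X_2, a translate of an
    earlier case, by X_1 turns X_2 into X_3 and g_q into g_(q+1). *)
Lemma fam_conjX1 k q : k \in [:: 0; 2; 4] -> 1 < q -> fam k q ^ fam 0 1%N = fam k q.+1.
Proof.
move=> kI; case: q => [//|[//|q]] _.
have [m le_m] := ubnP q; elim: m q le_m => // m IH [|[|q]] le_m; try exact: sat_shift.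
have X2 r : 0 < r -> r <= q.+2 -> fam k r.+2 ^ fam 0 2 = fam k r.+3.
  case: r => // r _ rq.
  rewrite (famS k r.+1) (famS 0 0) -conjJg IH ?famS //; lia.
rewrite -X2 //; rewrite conjJg IH; last lia.
rewrite (@sat_shift 0 2) // -[fam 0 3]/(fam 0 2 ^ fam 0 0) famS -conjJg X2 //.
Qed.

Lemma famC k p q : k \in [:: 0; 2; 4] -> p < q -> fam k q * fam 0 p = fam 0 p * fam k q.+1.
Proof.
move=> kI pq; apply/conj_sq; elim: p q pq => [|[|p] IH] [|[|q]] // pq.
  exact: fam_conjX1.
by rewrite !famS -conjJg IH.
Qed.

(** The element c_i commutes with X_(i+2), and conjugation by X_(i+2) carries g_q
    to g_(q+1) for q > i + 2; so the two cases q = i + 2, i + 3 suffice for i < 2,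
    and the other values of i are reached by conjugation with X_0. *)
Lemma fam_far k i q : k \in [:: 0; 2; 4] -> i.+1 < q ->
  fam 2 i * fam k q = fam k q * fam 2 i.
Proof.
move=> kI.
have base j d : j < 2 -> fam 2 j * fam k (j + d.+2) = fam k (j + d.+2) * fam 2 j.
  move=> j2.
  have near k' m : k' \in [:: 0; 2; 4] -> m \in [:: 2; 3] ->
      fam 2 j * fam k' (j + m) = fam k' (j + m) * fam 2 j.
    move=> k'I mI; apply: sat_far => //; move: mI; rewrite !inE.
    by case: j j2 => [|[|]] // _ /orP[] /eqP->.
  elim: d => [|[|d] IH]; try exact: near.
  have hX := near 0 2 isT isT.
  have -> : fam k (j + d.+4) = fam k (j + d.+3) ^ fam 0 (j + 2).
    by symmetry; apply/conj_sq; rewrite !(addnS j) famC //; lia.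
  by rewrite -[fam 2 j](iffRL (conj_sq _ _ _) hX) -!conjMg IH.
elim: i q => [|[|i] IH] q iq.
- by rewrite (_ : q = 0 + (q - 2).+2)%N; [exact: base | lia].
- by rewrite (_ : q = 1 + (q - 3).+2)%N; [exact: base | lia].
- case: q iq => [|[|q]] // iq.
  by rewrite (famS 2 i) (famS k q) -!conjMg IH.
Qed.

Lemma fam_invol k p : k \in [:: 2; 4] -> fam k p * fam k p = 1.
Proof.
move=> kI; elim: p => [|[|p] IH]; try exact: sat_invol.
by rewrite famS -conjMg IH conj1g.
Qed.

(** Carets at two distinct leaves can be attached in either order; the index of
    the right one grows when the left one comes first. *)
Lemma comb_XX n p q : p < q -> q < n -> X n q * X n.+1 p = X n p * X n.+1 q.+1.
Proof.
move=> pq qn; rewrite /comb_X !ltnS (_ : p.+1 < n); last lia.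
rewrite (_ : p < n); last lia.
case: ifP => _; last by rewrite mul1g mulg1.
by apply: famC => //; lia.
Qed.

Lemma comb_X_last n : X n.+1 n = 1.
Proof. by rewrite /comb_X ltnn. Qed.

Lemma comb_cX_lt n p k : p < k -> k.+1 < n -> c n k * X n p = X n p * c n.+1 k.+1.
Proof.
move=> pk kn; rewrite /comb_X /comb_c !ltnS (_ : p.+1 < n); last lia.
by case: ifP => _; apply: famC.
Qed.

Lemma comb_cX_gt n p k : k.+1 < p -> p < n -> c n k * X n p = X n p * c n.+1 k.
Proof.
move=> kp pn; rewrite /comb_X /comb_c (_ : k.+2 < n); last lia.
rewrite (_ : k.+2 < n.+1); last lia.
case: ifP => _; last by rewrite mul1g mulg1.
by apply: fam_far => //; lia.
Qed.

Lemma comb_cc n k l : k.+1 < l -> l.+1 < n -> c n k * c n l = c n l * c n k.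
Proof.
move=> kl ln; rewrite /comb_c (_ : k.+2 < n); last lia.
by case: ifP => _; apply: fam_far.
Qed.

Lemma comb_cK n k : c n k * c n k = 1.
Proof. by rewrite /comb_c; case: ifP => _; apply: fam_invol. Qed.

(** * Flips of arbitrary width away from carets and from other flips *)

Lemma comb_S0 n i : S 0 n i = 1.
Proof. by rewrite comb_S.unlock. Qed.

Lemma comb_S_succ w n i :
  S w.+1 n.+1 i = c n.+1 i * (X n i)^-1 * S w n i * X n (i + w).
Proof. by rewrite comb_S.unlock. Qed.

Lemma comb_S1 n i : S 1 n.+1 i = c n.+1 i.
Proof. by rewrite comb_S_succ comb_S0 addn0 mulg1 mulgVK. Qed.

Lemma comb_SX_lt w n p i : p < i -> i + w < n ->
  S w n i * X n p = X n p * S w n.+1 i.+1.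
Proof.
move=> pi; elim: w n => [|w IH] [|n] // iwn; first by rewrite !comb_S0 mul1g mulg1.
rewrite !comb_S_succ addSn (mulg_sq (comb_XX _ _)); [|lia..].
rewrite (mulg_sq (IH _ _)); [|lia..].
rewrite (mulg_sqV (esym (comb_XX _ _))); [|lia..].
rewrite comb_cX_lt ?mulgA //; lia.
Qed.

Lemma comb_SX_gt w n p i : i + w < p -> p < n ->
  S w n i * X n p = X n p * S w n.+1 i.
Proof.
elim: w n p => [|w IH] [|n] [|p] // ip pn; first by rewrite !comb_S0 mul1g mulg1.
rewrite !comb_S_succ (mulg_sq (esym (comb_XX _ _))); [|lia..].
rewrite (mulg_sq (IH _ _ _ _)); [|lia..].
rewrite (mulg_sqV (comb_XX _ _)); [|lia..].
rewrite comb_cX_gt ?mulgA //; lia.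
Qed.

Lemma comb_Sc_far w n i k : i + w < n -> k.+1 < n -> k.+1 < i \/ i + w < k ->
  S w n i * c n k = c n k * S w n i.
Proof.
elim: w n k => [|w IH] [|n] k // iwn kn ki; first by rewrite !comb_S0 mul1g mulg1.
rewrite !comb_S_succ; case: ki => ki.
- rewrite (mulg_sq (esym (comb_cX_gt _ _))); [|lia..].
  rewrite (mulg_sq (IH _ _ _ _ _)); [|lia..].
  rewrite (mulg_sqV (comb_cX_gt _ _)); [|lia..].
  by rewrite -(comb_cc ki) ?mulgA; last lia.
- case: k => // k in kn ki *; rewrite (mulg_sq (esym (comb_cX_lt _ _))); [|lia..].
  rewrite (mulg_sq (IH _ _ _ _ _)); [|lia..].
  rewrite (mulg_sqV (comb_cX_lt _ _)); [|lia..].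
  by rewrite (@comb_cc n.+1 i k.+1) ?mulgA //; lia.
Qed.

Lemma comb_SS_far w v n i k : i + w < k -> k + v < n ->
  S w n i * S v n k = S v n k * S w n i.
Proof.
move=> ik; elim: v n => [|v IH] [|n] // kn; first by rewrite !comb_S0 mul1g mulg1.
rewrite !comb_S_succ !mulgA comb_Sc_far; [|lia..].
rewrite -(mulg_sqV (comb_SX_gt _ _)); [|lia..].
rewrite (mulg_sq (IH _ _)); [|lia..].
rewrite -!mulgA comb_SX_gt //; lia.
Qed.

(** The caret on the last leaf is trivial, and commuting with it adds a leaf on
    the right. *)
Lemma comb_S_stable w n i : i + w < n -> S w n.+2 i = S w n.+1 i.
Proof.
move=> iwn; have := @comb_SX_gt w n.+1 n i iwn (leqnn _).
by rewrite comb_X_last mulg1 mul1g.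
Qed.

Lemma comb_c_stable n k : k.+1 < n -> c n.+2 k = c n.+1 k.
Proof. by move=> kn; rewrite /comb_c !ifT //; lia. Qed.

Lemma comb_X_stable n k : k < n -> X n.+2 k = X n.+1 k.
Proof. by move=> kn; rewrite /comb_X !ifT //; lia. Qed.

(** * Independence of the leaf at which a flip is expanded *)

(** The instance of expand_rel at the leaf k of the interval. *)
Definition splits w n i k :=
  S w n i * X n (i + w - k) = X n (i + k) * c n.+1 (i + k) * S w.+1 n.+1 i.

Definition nests w n i k :=
  S w n i * c n (i + k) = c n (i + w - k.+1) * S w n i.

(** Conjugation by the caret at leaf 0, which lies on the left of everything. *)
Lemma splits_shift w n i k : 0 < i -> k <= w -> i + w < n ->
  splits w n i k -> splits w n.+1 i.+1 k.
Proof.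
move=> i0 kw iwn h; apply: (mulgI (X n 0)).
rewrite !mulgA -comb_SX_lt // addSn subSn; last lia.
rewrite (addSn i k) -[LHS]mulgA -[in LHS]comb_XX; [|lia..]; rewrite [LHS]mulgA h.
rewrite [LHS](mulg_sq (comb_SX_lt _ _)); [|lia..].
rewrite (mulg_sq (comb_cX_lt _ _)); [|lia..].
by rewrite comb_XX //; lia.
Qed.

Lemma nests_shift w n i k : 0 < i -> k < w -> i + w < n ->
  nests w n i k -> nests w n.+1 i.+1 k.
Proof.
move=> i0 kw iwn h; apply: (mulgI (X n 0)).
rewrite !mulgA -comb_SX_lt // (_ : i.+1 + w - k.+1 = (i + w - k.+1).+1)%N; last lia.
rewrite (addSn i k) -[LHS]mulgA -[in LHS]comb_cX_lt; [|lia..]; rewrite [LHS]mulgA h.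
rewrite [LHS](mulg_sq (comb_SX_lt _ _)); [|lia..].
by rewrite comb_cX_lt //; lia.
Qed.

(** Reduction of a statement about an interval of width w starting at leaf i of a
    comb with n leaves to i < 2 and to at most one leaf on the right of it. *)
Lemma low_ind (P : nat -> nat -> Prop) w :
  (forall i b, i < 2 -> b < 2 -> P (i + w + b).+1 i) ->
  (forall n i, i + w < n -> P n.+1 i -> P n.+2 i) ->
  (forall n i, 0 < i -> i + w < n -> P n i -> P n.+1 i.+1) ->
  forall n i, i + w < n -> P n i.
Proof.
move=> base up shift.
have low i n : i < 2 -> i + w < n -> P n i.
  move=> i2 iwn; rewrite -(subnKC iwn) addSn.
  elim: (n - (i + w).+1)%N => [|b IH]; first exact: base.
  by case: b IH => [|b] IH; [exact: base | rewrite addnS; apply: up; [lia | exact: IH]].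
move=> n i; elim: i n => [|i IH] [|n] // iwn; first exact: low.
have [i0|i0] := posnP i; first by apply: low => //; lia.
by apply: shift => //; apply: IH.
Qed.

Lemma splits_base w k n i : (w, k) \in [:: (1, 1); (2, 1); (2, 2)]%N -> i + w < n ->
  splits w n i k.
Proof.
move=> wk; have kw : k <= w by move: wk; rewrite !inE => /or3P[] /eqP[-> ->].
apply: (@low_ind (fun n i => splits w n i k)) => {n i} [i b i2 b2|n i iwn h|n i i0 iwn].
- exact: sat_expand.
- rewrite /splits (@comb_S_stable w n) ?(@comb_S_stable w.+1 n.+1) ?(@comb_X_stable n)
    ?(@comb_c_stable n.+1) //; lia.
- exact: splits_shift.
Qed.

Lemma nests_base w k n i : (w, k) \in [:: (2, 0); (2, 1); (3, 1)]%N -> i + w < n ->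
  nests w n i k.
Proof.
move=> wk; have kw : k < w by move: wk; rewrite !inE => /or3P[] /eqP[-> ->].
apply: (@low_ind (fun n i => nests w n i k)) => {n i} [i b i2 b2|n i iwn h|n i i0 iwn].
- exact: sat_nest.
- by rewrite /nests comb_S_stable // !(@comb_c_stable n) //; lia.
- exact: nests_shift.
Qed.

(** Solved for the wider flip; c is an involution. *)
Lemma splitsE w n i k : splits w n i k <->
  S w.+1 n.+1 i = c n.+1 (i + k) * (X n (i + k))^-1 * S w n i * X n (i + w - k).
Proof.
rewrite /splits; split=> [h|->]; last first.
  by rewrite -!mulgA [c _ _ * (c _ _ * _)]mulgA comb_cK mul1g mulVKg.
by rewrite -[RHS]mulgA h !mulgA mulgVK comb_cK mul1g.
Qed.

(** The two candidates for the flip of width v.+2 obtained by merging its leaves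
    p, p + 1, respectively r + 1, r + 2.  These pairs are disjoint; merging the
    other pair next expresses both candidates through the same flip of width v. *)
Lemma splits_diamond v n i p r : i + v.+1 < n.+1 ->
  (forall k, k <= v -> splits v n i k) -> p < r -> r <= v ->
  c n.+2 (i + p) * (X n.+1 (i + p))^-1 * S v.+1 n.+1 i * X n.+1 (i + v.+1 - p) =
  c n.+2 (i + r.+1) * (X n.+1 (i + r.+1))^-1 * S v.+1 n.+1 i * X n.+1 (i + v.+1 - r.+1).
Proof.
move=> ivn IH pr rv.
rewrite {1}(iffLR (splitsE v n i r) (IH _ _)); [|lia..].
rewrite (iffLR (splitsE v n i p) (IH _ _)); [|lia..].
rewrite !mulgA (mulg_sqV (comb_cX_lt _ _)); [|lia..].
rewrite (addnS i r) (mulg_sqV (@comb_cX_gt n.+1 (i + r).+1 (i + p) _ _)); [|lia..].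
rewrite (mulg_sqVV (comb_XX _ _)); [|lia..].
rewrite -[in RHS]comb_cc; [|lia..].
have -> : (i + v.+1 - p = (i + v - p).+1)%N by lia.
have -> : (i + v.+1 - r.+1 = i + v - r)%N by lia.
by rewrite [RHS](mulg_sq (comb_XX _ _)); [|lia..].
Qed.

(** The leaves k + 1 and 0 are related by splits_diamond except when they are
    adjacent; the leaf 3 is then far from both, and exists from width 3 on. *)
Lemma comb_S_splits w n i k : k <= w -> i + w < n -> splits w n i k.
Proof.
elim: w n i k => [|w IH] n i k kw iwn.
  by case: k kw => // _; apply/splitsE; rewrite subn0 comb_S_succ !addn0.
case: k kw => [|k] kw; first by apply/splitsE; rewrite subn0 comb_S_succ addn0.
case: w IH iwn kw => [|[|w]] IH iwn kw.
- by apply: splits_base => //; case: k kw => [|[|k]].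
- by apply: splits_base => //; case: k kw => [|[|k]].
case: n iwn => // n iwn.
pose val p := c n.+2 (i + p) * (X n.+1 (i + p))^-1 * S w.+3 n.+1 i *
  X n.+1 (i + w.+3 - p).
have far p r : p < r -> r <= w.+2 -> val p = val r.+1.
  by move=> pr rw; apply: splits_diamond => // k' k'w; apply: IH => //; lia.
have val0 : val k.+1 = val 0.
  case: k kw => [|k] kw; last by rewrite (far 0 k.+1).
  by rewrite (far 1%N 2) // (far 0 2).
by apply/splitsE; rewrite -/(val k.+1) val0 /val comb_S_succ addn0 subn0.
Qed.

(** Expand the large flip at a leaf p such that the caret at p is disjoint from the
    image of the two flipped leaves: the small flip then passes through the caret
    and meets a narrower large flip.  Such a p exists from width 3 on, except for
    the middle pair in width 3. *)
Lemma comb_S_nest2 w n i k : k < w -> i + w < n -> nests w n i k.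
Proof.
elim: w n i k => [|w IH] n i k kw iwn //.
have [|nbase] := boolP ((w.+1, k) \in [:: (2, 0); (2, 1); (3, 1)]%N).
  by move=> h; exact: nests_base.
case: n iwn => // n iwn.
case: w IH iwn kw nbase => [|w] IH iwn kw nbase.
  by case: k kw {nbase} => // _; rewrite /nests comb_S1 addn0 addnK.
have [p [pw far]] : exists p, p <= w.+1 /\ (p.+1 < w.+1 - k \/ (w.+1 - k).+1 < p).
  case: (ltnP 1 (w.+1 - k)) => h; [exists 0%N | exists w.+1]; first lia.
  by move: nbase; rewrite !inE !xpair_eqE; lia.
have h : splits w.+1 n i p by apply: comb_S_splits; lia.
rewrite /nests (iffLR (splitsE w.+1 n i p) h); case: far => far.
- rewrite (mulg_sq (esym (comb_cX_gt _ _))); [|lia..].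
  rewrite (mulg_sq (IH _ _ _ _ _)); [|lia..].
  rewrite (_ : i + w.+2 - k.+1 = (i + w.+1 - k.+1).+1)%N; last lia.
  rewrite (mulg_sqV (comb_cX_lt _ _)); [|lia..].
  rewrite comb_cc ?mulgA //; lia.
- case: k kw far {nbase} => [|k] kw far; first lia.
  rewrite (addnS i k) (mulg_sq (esym (comb_cX_lt _ _))); [|lia..].
  rewrite (mulg_sq (IH _ _ _ _ _)); [|lia..].
  rewrite (_ : i + w.+2 - k.+2 = i + w.+1 - k.+1)%N; last lia.
  rewrite (mulg_sqV (comb_cX_gt _ _)); [|lia..].
  rewrite -comb_cc ?mulgA //; lia.
Qed.

(** The expansion at the mirror image of k, with c moved to the other end by
    comb_S_nest2. *)
Lemma comb_S_split_right w n i k : k <= w -> i + w < n ->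
  S w.+1 n.+1 i = (X n (i + w - k))^-1 * S w n i * X n (i + k) * c n.+1 (i + k).
Proof.
move=> kw iwn.
have h : splits w n i (w - k) by apply: comb_S_splits => //; lia.
have n2 : nests w.+1 n.+1 i k by apply: comb_S_nest2; lia.
rewrite -[LHS](mulgK (c n.+1 (i + k))) n2 (iffLR (splitsE _ _ _ _) h).
rewrite (_ : i + w.+1 - k.+1 = i + (w - k))%N; last lia.
rewrite (_ : i + w - (w - k) = i + k)%N; last lia.
rewrite (_ : i + w - k = i + (w - k))%N; last lia.
by rewrite !mulgA comb_cK mul1g (mulg1_eq (comb_cK _ _)).
Qed.

Lemma comb_S_split_left w n i k : k <= w -> i + w < n ->
  S w.+1 n.+1 i = c n.+1 (i + k) * (X n (i + k))^-1 * S w n i * X n (i + w - k).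
Proof. by move=> kw iwn; apply/splitsE/comb_S_splits. Qed.

(** The left expansion of the first factor cancels with the right expansion of the
    second one. *)
Lemma comb_SK w n i : i + w < n -> S w n i * S w n i = 1.
Proof.
elim: w n => [|w IH] [|n] // iwn; first by rewrite comb_S0 mulg1.
have iw : i + w < n by lia.
rewrite {1}(@comb_S_split_left w n i 0) // (@comb_S_split_right w n i 0) // !addn0 subn0.
rewrite !mulgA mulgK -[_ * S w n i * S w n i]mulgA IH //.
by rewrite mulg1 mulgVK comb_cK.
Qed.

(** Expand the inner flip at its first leaf k.  After its factor c has crossed the
    outer flip, the outer flip expanded at the image of k cancels that factor and
    the caret, which leaves the relation for both widths decreased by one. *)
Lemma comb_S_nest w v n i k : k + v <= w -> i + w < n ->
  S w n i * S v n (i + k) = S v n (i + w - k - v) * S w n i.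
Proof.
elim: v w n k => [|v IH] [|w] [|n] k // kvw iwn; rewrite ?comb_S0 ?mulg1 ?mul1g //; try lia.
rewrite (@comb_S_split_left v n (i + k) 0) ?addn0 ?subn0; [|lia..].
rewrite !mulgA comb_S_nest2; [|lia..].
rewrite {1}(@comb_S_split_left w n i (w - k)); [|lia..].
rewrite (_ : i + w.+1 - k.+1 = i + (w - k))%N; last lia.
rewrite (_ : i + w - (w - k) = i + k)%N; last lia.
rewrite !mulgA comb_cK mul1g mulgK (mulg_sq (IH _ _ _ _ _)); [|lia..].
rewrite (@comb_S_split_right v n (i + w.+1 - k - v.+1) 0) ?addn0 ?subn0; [|lia..].
rewrite (@comb_S_split_left w n i (w - k - v)); [|lia..].
rewrite (_ : i + w.+1 - k - v.+1 = i + (w - k - v))%N; last lia.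
rewrite (_ : i + w - (w - k - v) = i + k + v)%N; last lia.
rewrite (_ : i + (w - k - v) + v = i + (w - k))%N; last lia.
rewrite (_ : i + w - k - v = i + (w - k - v))%N; last lia.
by rewrite !mulgA -[_ * c _ _ * c _ _]mulgA comb_cK mulg1 mulgK.
Qed.

(** * The homomorphism from CV to a group satisfying the relations *)

Definition comb_gen n (g : cactus_index n) : G :=
  S ((val g).2 - (val g).1) n (val g).1.

Lemma comb_gen_rel n l r : cactus_rel l r ->
  word_eval (@comb_gen n) l = word_eval (@comb_gen n) r.
Proof.
case=> {l r} [[[i j] /= ij]|[[i j] /= ij] [[k l] /= kl] /= jk|
    [[i j] /= ij] [[k l] /= kl] [[k' l'] /= kl'] /= ik lj [e1 e2]];
  rewrite /word_eval /= ?big_cons ?big_nil ?mulg1 /comb_gen /=.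
- by rewrite comb_SK //; lia.
- by apply: comb_SS_far; lia.
- have := @comb_S_nest (j - i) (l - k) n i (k - i) _ _.
  rewrite (_ : i + (k - i) = k)%N; last lia.
  rewrite (_ : i + (j - i) - (k - i) - (l - k) = k')%N; last lia.
  rewrite (_ : l' - k' = l - k)%N; last lia.
  by apply; lia.
Qed.

Definition cactus_hom n : cactus n -> G := pres_lift (@comb_gen n).

Lemma cactus_homM n : {morph @cactus_hom n : s t / s * t}.
Proof. exact/pres_liftM/comb_gen_rel. Qed.

Lemma cactus_hom1 n : cactus_hom (1 : cactus n) = 1.
Proof. by apply: (mulgI (cactus_hom (1 : cactus n))); rewrite -cactus_homM !mulg1. Qed.

Lemma cactus_hom_sgen n i j : i < j -> j < n -> cactus_hom (sgen n i j) = S (j - i) n i.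
Proof.
move=> ij jn; have h : (i, j).1 < (i, j).2 < n by rewrite ij.
by rewrite (sgenE h) /cactus_hom /cactus_gen pres_lift_gen //; exact: comb_gen_rel.
Qed.

(** All expansions of all elements of the cactus group reduce to those of the
    generators, at a leaf on the right, on the left or inside of the interval. *)
Lemma cactus_hom_xpd n p (s : cactus n) : p < n ->
  cactus_hom s * X n (pos p s) = X n p * cactus_hom (xpd p s).
Proof.
elim/cactus_ind: s p => [|g s IH] p pn; first by rewrite pos1 xpd1 !cactus_hom1 mulg1 mul1g.
rewrite xpdM posM !cactus_homM xpd_gen -mulgA IH; last first.
  by rewrite pos_gen (flip_ltn g (Ordinal pn)).
rewrite !mulgA; congr (_ * _); rewrite pos_gen (sgen_sval g).
case: g => -[i j] /= ij; rewrite cactus_hom_sgen; [|lia..].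
case: (expand_gen_cases p (exist _ (i, j) ij)) => -[/= h ->]; rewrite /flip ?h.
- rewrite ifF; last lia.
  by rewrite comb_SX_gt ?cactus_hom_sgen //; lia.
- rewrite ifF; last lia.
  by rewrite comb_SX_lt ?cactus_hom_sgen //; try lia; rewrite subSS.
- rewrite cactus_homM !cactus_hom_sgen; [|lia..].
  have := @comb_S_splits (j - i) n i (p - i) _ _; rewrite /splits.
  rewrite (_ : p.+1 - p = 1)%N; last lia.
  rewrite (_ : i + (j - i) - (p - i) = i + j - p)%N; last lia.
  rewrite (_ : i + (p - i) = p)%N; last lia.
  rewrite (_ : j.+1 - i = (j - i).+1)%N; last lia.
  by rewrite comb_S1 mulgA; apply; lia.
Qed.

(** The product of the carets that replace leaf k of the comb with n leaves by the
    tree t.  The right subtree is grown first, so that the index of the leaf where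
    the left one is grown does not change. *)
Fixpoint graft (k n : nat) (t : tree) : G :=
  if t is Node l r then X n k * graft k.+1 n.+1 r * graft k (n + leaves r) l else 1.

(** Growing a tree at leaf k renumbers the leaves q > k. *)
Lemma X_graft t k n q : k < q -> q < n ->
  X n q * graft k n.+1 t = graft k n t * X (n + leaves t).-1 (q + leaves t).-1.
Proof.
elim: t k n q => [|l IHl r IHr] k n q kq qn /=.
  by rewrite mulg1 mul1g !addn1.
rewrite !mulgA comb_XX // (mulg_sq (IHr _ _ _ _ _)) //.
rewrite !addSn /= (mulg_sq (IHl _ _ _ _ _)); [|lia..].
by rewrite (addnC (leaves l)) !addnA.
Qed.

Lemma graft_attach t k n i : k < n -> i < leaves t ->
  graft k n (attach t i) = graft k n t * X (n + leaves t).-1 (k + i).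
Proof.
elim: t k n i => [|l IHl r IHr] k n i kn /=.
  by case: i => // _; rewrite !mulg1 mul1g addn1 addn0.
move=> ir; case: ifP => il /=.
  rewrite IHl; [|lia..].
  by rewrite mulgA (addnC (leaves l)) addnA.
rewrite IHr; [|lia..].
rewrite leaves_attach (addnS n) mulgA -[LHS]mulgA.
rewrite (_ : (n.+1 + leaves r).-1 = n + leaves r)%N; last lia.
rewrite (@X_graft l); [|lia..].
rewrite (addnC (leaves l)) addnA mulgA; congr (_ * X _ _); lia.
Qed.

(** The image of [t, 1, R_n], where n is the number of leaves of t. *)
Definition tree_elt (t : tree) : G := graft 0 1 t.

Lemma tree_elt_attach t i : i < leaves t ->
  tree_elt (attach t i) = tree_elt t * X (leaves t) i.
Proof. exact: graft_attach. Qed.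

Definition pair_elt (x : cactus_tree_pair) : G :=
  let: (Tp, s, Tm) := tagged x in
  tree_elt (val Tp) * cactus_hom s * (tree_elt (val Tm))^-1.

(** The caret of the expanded tree on the left moves through the image of s by
    cactus_hom_xpd, and cancels with the caret on the right. *)
Lemma pair_elt_expand x i : pair_elt (expand (x := x) i) = pair_elt x.
Proof.
case: x i => n [[Tp s] Tm] i; rewrite /pair_elt /expand /expand_triple /=.
rewrite !tree_elt_attach ?(eqP (valP Tp)) ?(eqP (valP Tm)) //.
rewrite posE invgM mulgA -[tree_elt _ * X n i * _]mulgA -cactus_hom_xpd //.
by rewrite mulgA mulgK.
Qed.

Lemma pair_elt_star x y : star x y -> pair_elt y = pair_elt x.
Proof. by elim=> // {}y i _ <-; exact: pair_elt_expand. Qed.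

Definition CV_hom (u : CV) : G := pair_elt (repr u).

Lemma CV_homE x : CV_hom (CV_class x) = pair_elt x.
Proof.
have /CV_classP/ctp_equivP[z [xz yz]] := CV_reprK (CV_class x).
by rewrite /CV_hom -(pair_elt_star xz) -(pair_elt_star yz).
Qed.

Lemma CV_homM : {morph CV_hom : u v / u * v}.
Proof.
move=> u v; rewrite -[u]CV_reprK -[v]CV_reprK.
have [x [y [z [ux vy p]]]] := ctp_product_refine (repr u) (repr v).
rewrite (CV_class_star ux) (CV_class_star vy).
rewrite [CV_class x * CV_class y](CV_mulE p) !CV_homE.
by case: p => n Sp Sm Tm s t; rewrite /pair_elt /= cactus_homM !mulgA mulgVK.
Qed.

End Theory.

(** * The generators in CV *)

Lemma grow_subproof n (t : ntree n) p : leaves (attach (val t) p) == n.+1.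
Proof. by rewrite leaves_attach (eqP (valP t)). Qed.

Definition grow n (t : ntree n) (p : nat) : ntree n.+1 :=
  Sub (attach (val t) p) (grow_subproof t p).

(** The index counts carets: this is R_(m+1). *)
Fixpoint comb m : tree := if m is m'.+1 then Node Leaf (comb m') else Leaf.

Lemma leaves_comb m : leaves (comb m) == m.+1.
Proof. by elim: m => //= m /eqP->. Qed.

Definition ncomb m : ntree m.+1 := Sub (comb m) (leaves_comb m).

Lemma attach_comb m : attach (comb m) m = comb m.+1.
Proof. by elim: m => //= m IH; rewrite subSS subn0 IH. Qed.

Definition CV_triple n (T : ntree n) (s : cactus n) (U : ntree n) : (CV : groupType) :=
  CV_class (ctp T s U).

Lemma CV_triple_mul n (T U W : ntree n) (s t : cactus n) :
  CV_triple T s U * CV_triple U t W = CV_triple T (s * t) W.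
Proof. exact/CV_mulE/CtpProduct. Qed.

Lemma CV_triple_grow n (T U : ntree n) (s : cactus n) p : p < n ->
  CV_triple T s U = CV_triple (grow T p) (xpd p s) (grow U (pos p s)).
Proof.
move=> pn; rewrite /CV_triple (CV_class_star (star_expand (x := ctp T s U) (Ordinal pn))).
congr CV_class; rewrite /expand /expand_triple /ctp /=; congr Tagged; congr (_, _, _).
  exact: val_inj.
by apply: val_inj; rewrite /= posE.
Qed.

Definition CV_X m p : (CV : groupType) := CV_triple (grow (ncomb m) p) 1 (ncomb m.+1).

Definition CV_S m (s : cactus m.+1) : (CV : groupType) := CV_triple (ncomb m) s (ncomb m).

Lemma CV_X_last m : CV_X m m = 1.
Proof.
rewrite /CV_X (_ : grow _ _ = ncomb m.+1) ?[LHS]CV_oneE //.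
by apply: val_inj; rewrite /= attach_comb.
Qed.

Lemma CV_SM m : {morph @CV_S m : s t / s * t}.
Proof. by move=> s t; rewrite /CV_S CV_triple_mul. Qed.

Lemma CV_S1 m : CV_S (1 : cactus m.+1) = 1.
Proof. exact: CV_oneE. Qed.

(** Both sides are the class of (R + p, xpd p s, R), for the combs R of the two
    sizes. *)
Lemma CV_SX m p (s : cactus m.+1) : p <= m ->
  CV_S s * CV_X m (pos p s) = CV_X m p * CV_S (xpd p s).
Proof.
move=> pm; rewrite /CV_S (@CV_triple_grow m.+1 _ _ s p) //.
by rewrite !CV_triple_mul mulg1 mul1g.
Qed.

(** Both sides are the class of the comb with carets at p and q, paired with a
    comb. *)
Lemma CV_XX m p q : p < q -> q <= m ->
  CV_X m q * CV_X m.+1 p = CV_X m p * CV_X m.+1 q.+1.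
Proof.
move=> pq qm.
rewrite /CV_X (@CV_triple_grow _ (grow (ncomb m) q) _ _ p) ?xpd1 ?pos1; last lia.
rewrite (@CV_triple_grow _ (grow (ncomb m) p) _ _ q.+1) ?xpd1 ?pos1 //.
rewrite !CV_triple_mul; congr CV_triple; apply: val_inj => /=.
have l := eqP (leaves_comb m).
have := @attach_shift (comb m) q p; rewrite l /shift pq ifF; last lia.
by apply; lia.
Qed.

Lemma CV_X_stable m p : p < m -> CV_X m.+1 p = CV_X m p.
Proof.
by move=> pm; have := @CV_XX m p m pm (leqnn m); rewrite !CV_X_last mul1g mulg1.
Qed.

Lemma CV_X_shift m q : 0 < q <= m -> CV_X m.+1 q.+1 = CV_X m q ^ CV_X m 0.
Proof.
move=> /andP[q0 qm]; apply/esym/conj_sq; rewrite -CV_XX // CV_X_stable //; lia.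
Qed.

Definition CV_s m i j : (CV : groupType) := CV_S (sgen m.+1 i j).

Lemma CV_sX_lt m i j p : p < i -> i < j -> j <= m ->
  CV_s m i j * CV_X m p = CV_X m p * CV_s m.+1 i.+1 j.+1.
Proof.
move=> pi ij jm; have ijm : i < j < m.+1 by rewrite ij.
have pm : p <= m by lia.
have := CV_SX (sgen m.+1 i j) pm; rewrite pos_sgen // /flip ifF; last lia.
by case: (xpd_sgen p ijm) => -[h ->] //; lia.
Qed.

Lemma CV_sX_gt m i j p : i < j -> j < p -> p <= m ->
  CV_s m i j * CV_X m p = CV_X m p * CV_s m.+1 i j.
Proof.
move=> ij jp pm; have ijm : i < j < m.+1 by lia.
have := CV_SX (sgen m.+1 i j) pm; rewrite pos_sgen // /flip ifF; last lia.
by case: (xpd_sgen p ijm) => -[h ->] //; lia.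
Qed.

Lemma CV_sX_in m i j p : i <= p <= j -> j <= m ->
  CV_s m i j * CV_X m (i + j - p) =
  CV_X m p * CV_s m.+1 p p.+1 * CV_s m.+1 i j.+1.
Proof.
move=> ipj jm; have pm : p <= m by lia.
have [ij|ij] := ltnP i j.
  have ijm : i < j < m.+1 by rewrite ij.
  have := CV_SX (sgen m.+1 i j) pm; rewrite pos_sgen // /flip ipj => ->.
  by case: (xpd_sgen p ijm) => -[h ->]; try lia; rewrite CV_SM mulgA.
have [-> ->] : i = p /\ j = p by lia.
rewrite /CV_s -mulgA -CV_SM sgenK CV_S1 sgen_junk ?CV_S1 ?mul1g ?mulg1 ?addnK //.
by rewrite ltnn.
Qed.

Lemma CV_s_stable m i j : i < j -> j < m -> CV_s m.+1 i j = CV_s m i j.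
Proof.
by move=> ij jm; have := @CV_sX_gt m i j m ij jm (leqnn m); rewrite CV_X_last mul1g mulg1.
Qed.

Lemma CV_s_shift m i j : 0 < i -> i < j -> j <= m ->
  CV_s m.+1 i.+1 j.+1 = CV_s m i j ^ CV_X m 0.
Proof. by move=> i0 ij jm; apply/esym/conj_sq/CV_sX_lt. Qed.

(** The smallest combs in which the positions 0 and 1 of each family make sense. *)
Definition CV_gens (k : 'I_6) : (CV : groupType) :=
  nth 1 [:: CV_X 1 0; CV_X 2 1; CV_s 2 0 1; CV_s 3 1 2; CV_s 1 0 1; CV_s 2 1 2] k.

Local Notation CV_fam := (fam CV_gens).

Lemma stable_from (T : Type) (f : nat -> T) m n :
  (forall k, m <= k -> f k.+1 = f k) -> m <= n -> f n = f m.
Proof.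
move=> h /subnKC<-; elim: (n - m)%N => [|d IH]; first by rewrite addn0.
by rewrite addnS h ?leq_addr.
Qed.

Lemma CV_fam0 m : 0 < m -> CV_fam 0 0 = CV_X m 0.
Proof.
move=> m0; rewrite (stable_from (f := CV_X^~ 0%N) (m := 1)) //; last first.
  by move=> k /CV_X_stable.
by rewrite /= /CV_gens inordK.
Qed.

Lemma CV_famX m p : p < m -> CV_fam 0 p = CV_X m p.
Proof.
move=> pm; rewrite (stable_from (f := CV_X^~ p) (m := p.+1)) //; last first.
  by move=> k /CV_X_stable.
elim: p {m pm} => [|[|p] IH]; try by rewrite /= /CV_gens inordK.
by rewrite famS IH (@CV_fam0 p.+2) // [RHS]CV_X_shift //= leqnSn.
Qed.

Lemma CV_famc m p : p.+1 < m -> CV_fam 2 p = CV_s m p p.+1.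
Proof.
move=> pm; rewrite (stable_from (f := fun m => CV_s m p p.+1) (m := p.+2)) //; last first.
  by move=> k pk; apply: CV_s_stable.
elim: p {m pm} => [|[|p] IH]; try by rewrite /= /CV_gens inordK.
by rewrite famS IH (@CV_fam0 p.+3) // [RHS]CV_s_shift ?leqnSn.
Qed.

Lemma CV_fame p : CV_fam 4 p = CV_s p.+1 p p.+1.
Proof.
elim: p => [|[|p] IH]; try by rewrite /= /CV_gens inordK.
by rewrite famS IH (@CV_fam0 p.+2) // [RHS]CV_s_shift ?leqnSn.
Qed.

Lemma comb_X_CV m p : p <= m -> comb_X CV_gens m.+1 p = CV_X m p.
Proof.
rewrite leq_eqVlt /comb_X ltnS => /predU1P[->|pm]; first by rewrite ltnn CV_X_last.
by rewrite pm; exact: CV_famX.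
Qed.

Lemma comb_c_CV m p : p < m -> comb_c CV_gens m.+1 p = CV_s m p p.+1.
Proof.
rewrite leq_eqVlt /comb_c ltnS => /predU1P[<-|pm]; first by rewrite ltnn CV_fame.
by rewrite pm; exact: CV_famc.
Qed.

(** The recursion that defines comb_S is an instance of CV_sX_in. *)
Lemma comb_S_CV w m i : i + w <= m -> comb_S CV_gens w m.+1 i = CV_s m i (i + w).
Proof.
elim: w m => [|w IH] m iwm.
  by rewrite comb_S0 /CV_s addn0 sgen_junk ?ltnn ?CV_S1.
case: m iwm => [|m] iwm; first lia.
rewrite comb_S_succ IH ?comb_X_CV ?comb_c_CV; [|lia..].
have h : i <= i <= i + w by rewrite leqnn leq_addr.
have := @CV_sX_in m i (i + w) i h.
rewrite addKn addnS => e; rewrite -[LHS]mulgA e; last lia.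
by rewrite !mulgA mulgVK -CV_SM sgenK CV_S1 mul1g.
Qed.

Lemma CV_fam_shift k q : k \in [:: 0; 2; 4] -> 1 < q ->
  CV_fam k q * CV_fam 0 1%N = CV_fam 0 1%N * CV_fam k q.+1.
Proof.
rewrite !inE => /or3P[] /eqP-> q1.
- rewrite (@CV_famX q.+1 q) // (@CV_famX q.+2 q.+1) // [in LHS](@CV_famX q.+2 1%N) //.
  rewrite (@CV_famX q.+1 1%N); last lia.
  by apply: CV_XX; lia.
- rewrite (@CV_famX q.+2) ?(@CV_famc q.+2 q) ?(@CV_famc q.+3 q.+1); [|lia..].
  by apply: CV_sX_lt; lia.
- rewrite (@CV_famX q.+1) ?CV_fame; [|lia..].
  by apply: CV_sX_lt; lia.
Qed.

Lemma CV_fam_far k i q : k \in [:: 0; 2; 4] -> i.+1 < q ->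
  CV_fam 2 i * CV_fam k q = CV_fam k q * CV_fam 2 i.
Proof.
rewrite !inE => /or3P[] /eqP-> iq.
- rewrite (@CV_famX q.+1) // (@CV_famc q.+1); last lia.
  by rewrite CV_sX_gt ?CV_s_stable //; lia.
- rewrite !(@CV_famc q.+2); [|lia..].
  by rewrite -!CV_SM sgenC.
- rewrite CV_fame (@CV_famc q.+1); last lia.
  by rewrite -!CV_SM sgenC.
Qed.

Lemma CV_gens_hold : holds (relations CV_gens).
Proof.
apply/holds_cat; split; last (apply/holds_cat; split; last (apply/holds_cat; split;
  last (apply/holds_cat; split))).
- move=> r /allpairsP[[k q] /= [kI qI ->]]; apply/conj_sq/CV_fam_shift => //.
  by move: qI; rewrite !inE => /orP[] /eqP->.
- move=> r /allpairsP[[k [i d]] /= [kI iI ->]]; apply: CV_fam_far => //.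
  by move: iI; rewrite !inE => /or4P[] /eqP[-> ->].
- move=> r /allpairsP[[k i] /= [kI _ ->]] /=; move: kI; rewrite !inE => /orP[] /eqP->.
    by rewrite (@CV_famc i.+2) // -CV_SM sgenK CV_S1.
  by rewrite CV_fame -CV_SM sgenK CV_S1.
- move=> r /allpairsP[[[w k] [i b]] /= [wkI _ ->]] /=.
  have kw : k <= w by move: wkI; rewrite !inE => /or3P[] /eqP[-> ->].
  rewrite !comb_S_CV ?comb_X_CV ?comb_c_CV; [|lia..].
  rewrite (addnS i w) -CV_sX_in; [|lia..].
  by congr (_ * CV_X _ _); lia.
- move=> r /allpairsP[[[w k] [i b]] /= [wkI _ ->]] /=.
  have kw : k < w by move: wkI; rewrite !inE => /or3P[] /eqP[-> ->].
  rewrite !comb_S_CV ?comb_c_CV; [|lia..].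
  by rewrite -!CV_SM; congr CV_S; apply: sgenN; lia.
Qed.

(** * The finite presentation *)

Section Morphisms.
Variables (G H : groupType) (f : G -> H) (fM : {morph f : x y / x * y}).

Lemma morph1g : f 1 = 1.
Proof. by apply: (mulgI (f 1)); rewrite -fM !mulg1. Qed.

Lemma morphVg x : f x^-1 = (f x)^-1.
Proof. by apply: (mulgI (f x)); rewrite -fM !mulgV morph1g. Qed.

Lemma morphJg x y : f (x ^ y) = f x ^ f y.
Proof. by rewrite !conjgE !fM morphVg. Qed.

Variable a : 'I_6 -> G.
Let fa k := f (a k).

Lemma morph_fam k p : f (fam a k p) = fam fa k p.
Proof.
case: p => //= p; elim: p => //= p IH.
by rewrite morphJg IH.
Qed.

Arguments fam : simpl never.

Lemma morph_comb_X n p : f (comb_X a n p) = comb_X fa n p.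
Proof. by rewrite /comb_X; case: ifP; rewrite ?morph1g ?morph_fam. Qed.

Lemma morph_comb_c n p : f (comb_c a n p) = comb_c fa n p.
Proof. by rewrite /comb_c; case: ifP; rewrite !morph_fam. Qed.

Lemma morph_comb_S w n i : f (comb_S a w n i) = comb_S fa w n i.
Proof.
rewrite comb_S.unlock; elim: w n i => [|w IH] n i /=; first exact: morph1g.
by rewrite !fM morphVg IH morph_comb_c !morph_comb_X.
Qed.

Definition map_rel (r : G * G) : H * H := (f r.1, f r.2).

Lemma morph_relations : map map_rel (relations a) = relations fa.
Proof.
rewrite /relations map_cat; congr cat; last rewrite map_cat; last congr cat;
  last rewrite map_cat; last congr cat; last rewrite map_cat; last congr cat;
  rewrite [LHS]map_allpairs; apply: eq_allpairs => x y; rewrite /map_rel /=.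
- by rewrite /shift_rel morphJg !morph_fam.
- by rewrite /far_rel !fM !morph_fam.
- by rewrite /invol_rel !fM !morph_fam morph1g.
- by rewrite /expand_rel !fM !morph_comb_S !morph_comb_X morph_comb_c.
- by rewrite /nest_rel !fM morph_comb_S !morph_comb_c.
Qed.

End Morphisms.

Section Words.
Variables (X : choiceType) (R : word X -> word X -> Prop) (H : groupType).
Variables (h : presented R -> H) (hM : {morph h : x y / x * y}).

Lemma morph_pres_class w : h (pres_class R w) = word_eval (fun x => h (pres_gen R x)) w.
Proof.
elim: w => [|[x b] w IH].
  by rewrite /word_eval big_nil; exact: (morph1g hM).
rewrite -cat1s pres_classM hM IH word_eval_cat; congr (_ * _).
rewrite /word_eval big_seq1 /=; case: b => //.
rewrite -(morphVg hM); congr h; apply: (mulgI (pres_gen R x)).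
rewrite mulgV /pres_gen -pres_classM.
by apply/pres_classP/rst_step/(Cancel R [::] [::]).
Qed.

End Words.

Definition no_rel (u v : word 'I_6) := False.

(** The relations are evaluated in the free group, where representatives of the
    classes turn them into pairs of words. *)
Definition free_gen : 'I_6 -> presented no_rel := pres_gen no_rel.

Definition CV_relators : seq (word 'I_6 * word 'I_6) :=
  [seq (repr r.1, repr r.2) | r <- relations free_gen].

Definition CV_rel (u v : word 'I_6) := (u, v) \in CV_relators.

(** The list of relations is natural in the group, and every family of six elements
    is the image of the free generators. *)
Lemma relations_lift (H : groupType) (a : 'I_6 -> H) :
  relations a = [seq (word_eval a r.1, word_eval a r.2) | r <- CV_relators].
Proof.
have fM := @pres_liftM _ no_rel H a (fun l r (e : no_rel l r) => match e with end).
have -> : relations a = relations (fun k => pres_lift a (free_gen k)).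
  by congr relations; apply: funext => k; rewrite pres_lift_gen.
by rewrite -(morph_relations fM) -map_comp; apply: eq_map.
Qed.

Lemma lift_respects (H : groupType) (a : 'I_6 -> H) : holds (relations a) <->
  forall l r, CV_rel l r -> word_eval a l = word_eval a r.
Proof.
rewrite relations_lift; split=> [h l r lr|h _ /mapP[[l r] lr ->]]; last exact: h.
exact: (h _ (map_f _ lr)).
Qed.

Definition pres_gens : 'I_6 -> presented CV_rel := pres_gen CV_rel.

Lemma pres_gens_hold : holds (relations pres_gens).
Proof.
apply/lift_respects => l r lr.
have id_morph : {morph (fun x : presented CV_rel => x) : x y / x * y} by [].
rewrite -!(morph_pres_class id_morph); apply/pres_classP.
rewrite -[l]cats0 -[r]cats0; exact/rst_step/(Relation [::]).
Qed.

Definition to_CV : presented CV_rel -> CV := pres_lift CV_gens.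

Lemma to_CVM : {morph to_CV : x y / x * y}.
Proof. exact/pres_liftM/(iffLR (lift_respects _))/CV_gens_hold. Qed.

Definition of_CV : CV -> presented CV_rel := CV_hom pres_gens.

Lemma of_CVM : {morph of_CV : u v / u * v}.
Proof. exact: CV_homM pres_gens_hold. Qed.

Section Combs.
Variables (G : groupType) (a : 'I_6 -> G).
Hypothesis sat : holds (relations a).

Lemma tree_elt_comb m : tree_elt a (comb m) = 1.
Proof.
elim: m => [//|m IH].
by rewrite -attach_comb tree_elt_attach ?(eqP (leaves_comb m)) // IH comb_X_last mulg1.
Qed.

Lemma CV_hom_X m p : p <= m -> CV_hom a (CV_X m p) = comb_X a m.+1 p.
Proof.
move=> pm; rewrite /CV_X /CV_triple CV_homE // /pair_elt /= cactus_hom1 //.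
rewrite tree_elt_attach ?(eqP (leaves_comb m)) // -[Node Leaf _]/(comb m.+1).
by rewrite !tree_elt_comb mul1g mulg1 (mulg1_eq (mulg1 1)) mulg1.
Qed.

Lemma CV_hom_s m i j : i < j -> j <= m -> CV_hom a (CV_s m i j) = comb_S a (j - i) m.+1 i.
Proof.
move=> ij jm; rewrite /CV_s /CV_S /CV_triple CV_homE // /pair_elt /=.
by rewrite cactus_hom_sgen // !tree_elt_comb mul1g (mulg1_eq (mulg1 1)) mulg1.
Qed.

End Combs.

(** Both sides are homomorphisms, so it suffices to follow the six generators. *)
Lemma to_CVK : cancel to_CV of_CV.
Proof.
move=> x; have fM : {morph (fun x => of_CV (to_CV x)) : x y / x * y}.
  by move=> y z; rewrite to_CVM of_CVM.
have idM : {morph (fun x : presented CV_rel => x) : x y / x * y} by [].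
rewrite -[x]pres_reprK (morph_pres_class fM) (morph_pres_class idM).
congr (word_eval _ _); apply: funext => k.
rewrite /to_CV pres_lift_gen; last exact/(iffLR (lift_respects _))/CV_gens_hold.
have sat := pres_gens_hold; rewrite -[RHS]/(pres_gens k) -[k]inord_val.
case: k => -[|[|[|[|[|[|//]]]]]] /= _; rewrite /CV_gens inordK //= /of_CV.
all: by rewrite ?(CV_hom_X sat) ?(CV_hom_s sat) ?comb_S1.
Qed.

(** CV is generated by the carets and the flips on right combs, which are images by
    the naturality of comb_X and comb_S. *)
Definition in_image (u : CV) := exists x, to_CV x = u.

Lemma in_imageM u v : in_image u -> in_image v -> in_image (u * v).
Proof. by move=> [x <-] [y <-]; exists (x * y); rewrite to_CVM. Qed.

Lemma in_imageV u : in_image u -> in_image u^-1.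
Proof. by move=> [x <-]; exists x^-1; rewrite (morphVg to_CVM). Qed.

Lemma in_image1 : in_image 1.
Proof. by exists 1; exact: (morph1g to_CVM). Qed.

Lemma to_CV_gens : (fun k => to_CV (pres_gens k)) = CV_gens.
Proof.
apply: funext => k; rewrite /to_CV pres_lift_gen //.
exact/(iffLR (lift_respects _))/CV_gens_hold.
Qed.

Lemma in_image_X m p : p <= m -> in_image (CV_X m p).
Proof.
move=> pm; exists (comb_X pres_gens m.+1 p).
by rewrite (morph_comb_X to_CVM) to_CV_gens comb_X_CV.
Qed.

Lemma in_image_S m (s : cactus m.+1) : in_image (CV_S s).
Proof.
elim/cactus_ind: s => [|g s IH]; first by rewrite CV_S1; exact: in_image1.
rewrite CV_SM; apply: in_imageM IH; rewrite sgen_sval.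
case: g => -[i j] /= /andP[ij jm]; exists (comb_S pres_gens (j - i) m.+1 i).
by rewrite (morph_comb_S to_CVM) to_CV_gens comb_S_CV ?subnKC //; lia.
Qed.

Lemma tree_attachP t : 1 < leaves t -> exists u i, i < leaves u /\ t = attach u i.
Proof.
elim: t => //= l IHl r IHr _; have [l1|l1] := ltnP 1 (leaves l).
  have [u [i [iu ->]]] := IHl l1; exists (Node u r), i => /=; rewrite iu; split=> //; lia.
have l1' : leaves l = 1%N by have := leaves_gt0 l; lia.
have [r1|r1] := ltnP 1 (leaves r).
  have [u [i [iu ->]]] := IHr r1; exists (Node l u), i.+1 => /=.
  by rewrite l1' subSS subn0; split.
have leaf t : leaves t <= 1 -> t = Leaf.
  by case: t => //= a b; have := leaves_gt0 a; have := leaves_gt0 b; lia.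
by exists Leaf, 0%N; rewrite (leaf l) // (leaf r).
Qed.

(** Induction on the carets of the tree: removing one of them divides by some
    CV_X. *)
Lemma in_image_tree m (T : ntree m.+1) : in_image (CV_triple T 1 (ncomb m)).
Proof.
elim: m T => [|m IH] [t tm].
  case: t tm => [|l r] tm; last first.
    by exfalso; move: tm => /=; have := leaves_gt0 l; have := leaves_gt0 r; lia.
  rewrite (_ : exist _ _ _ = ncomb 0); last exact: val_inj.
  by rewrite [X in in_image X]CV_oneE; exact: in_image1.
have [|u [i [iu tu]]] := @tree_attachP t; first by rewrite (eqP tm).
have um : leaves u == m.+1 by move: tm; rewrite tu leaves_attach.
have -> : exist _ t tm = grow (exist _ u um : ntree m.+1) i by apply: val_inj.
have im : i <= m by move: iu; rewrite (eqP um).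
have -> : CV_triple (grow (exist _ u um : ntree m.+1) i) 1 (ncomb m.+1) =
    CV_triple (exist _ u um : ntree m.+1) 1 (ncomb m) * CV_X m i.
  by rewrite (@CV_triple_grow _ _ (ncomb m) 1 i) // xpd1 pos1 CV_triple_mul mulg1.
by apply: in_imageM (IH _) (in_image_X im).
Qed.

Lemma in_image_all u : in_image u.
Proof.
rewrite -[u]CV_reprK; case: (repr u) => -[|m] [[T s] U].
  by have := leaves_gt0 (val T); rewrite (eqP (valP T)).
have -> : CV_class (ctp T s U) =
    CV_triple T 1 (ncomb m) * CV_S s * (CV_triple U 1 (ncomb m))^-1.
  rewrite [(CV_triple U 1 _)^-1]CV_invE -[CV_class (ctp _ 1^-1 _)]/(CV_triple _ _ _).
  by rewrite !CV_triple_mul mul1g (mulg1_eq (mulg1 1)) mulg1.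
by apply: in_imageM; [apply: in_imageM; [exact: in_image_tree | exact: in_image_S] |
  apply/in_imageV/in_image_tree].
Qed.

Theorem theorem5p1 : finitely_presented CV.
Proof.
exists 6, CV_relators, to_CV; split; first exact: to_CVM.
exists of_CV; first exact: to_CVK.
by move=> u; have [x <-] := in_image_all u; rewrite to_CVK.
Qed.
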